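(* If $q\in L_{1,1}(\mathbb{R}_+)$ decays faster than any exponential in the sense that $|q(x)|\le c\,e^{-c|x|^\gamma}$ for some constants $c>0$ and $\gamma>1$, then the phase shift data $\{\delta(k):k>0\}$ determine $q$ uniquely. That is, if $q_1,q_2\in L_{1,1}(\mathbb{R}_+)$ both satisfy such a bound (each with its own constants) and their phase shifts satisfy $\delta_1(k)=\delta_2(k)$ for all $k>0$, then $q_1=q_2$ almost everywhere.
   Context: $\mathbb{R}_+=(0,\infty)$; $L_{1,1}(\mathbb{R}_+)$ is the set of real-valued $q$ with $\int_0^\infty(1+x)|q(x)|\,dx<\infty$. For such $q$, the Jost solution $f(x,k)$ is the unique solution of $u''+k^2u-q(x)u=0$ on $x>0$ with $f(x,k)=e^{ikx}+o(1)$ as $x\to+\infty$, and $f(k):=f(0,k)$ is the Jost function. The $s$-wave phase shift $\delta(k)$ is the continuous real function on $(0,\infty)$ defined by $f(k)=|f(k)|e^{-i\delta(k)}$ and $\delta(\infty)=0$. No information about bound states or norming constants is included in the data. *)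

(* Defs.v *)
From HB Require Import structures.
From mathcomp Require Import all_boot all_order all_algebra.
From mathcomp Require Import complex.
From mathcomp Require Import all_classical all_reals all_analysis.
Set Implicit Arguments.
Unset Strict Implicit.
Unset Printing Implicit Defensive.
Import Order.TTheory GRing.Theory Num.Theory.
Import numFieldNormedType.Exports.
Local Open Scope classical_set_scope.
Local Open Scope ring_scope.
Local Open Scope complex_scope.

Section Defs.
Context {R : realType}.
Implicit Types (q v g delta : R -> R) (u w F : R -> R[i]) (k x : R).

Local Notation mu := (@lebesgue_measure R).

Definition Rplus : set R := `]0, +oo[.

Definition L11 q : Prop :=
  measurable_fun Rplus q /\
  (\int[mu]_(x in Rplus) ((1 + x) * `|q x|)%:E < +oo)%E.

(* Elements of L11 are only defined up to null sets, hence the a.e. bound. *)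
Definition superexp_decay q : Prop :=
  exists c gamma : R, [/\ 0 < c, 1 < gamma &
    {ae mu, forall x, 0 < x -> `|q x| <= c * expR (- c * `|x| `^ gamma)}].

Definition cabs (z : R[i]) : R := ComplexField.Normc.normc z.

Definition expi (t : R) : R[i] := cos t +i* sin t.

(* v is locally absolutely continuous on (0, oo) with a.e. derivative g, i.e.
   v is an indefinite integral of a locally integrable g. *)
Definition ac_deriv v g : Prop :=
  forall a b : R, 0 < a -> a <= b ->
    mu.-integrable `[a, b] (EFin \o g) /\
    v b - v a = \int[mu]_(x in `[a, b]) g x.

Definition ac_derivC u w : Prop :=
  ac_deriv (fun x => complex.Re (u x)) (fun x => complex.Re (w x)) /\
  ac_deriv (fun x => complex.Im (u x)) (fun x => complex.Im (w x)).

(* As q is merely integrable, solutions are in the Caratheodory sense: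
   u and u' = u1 are locally absolutely continuous on (0, oo), and
   u'' = u2 satisfies the equation almost everywhere. *)
Definition schrodinger_solution q k u : Prop :=
  exists u1 u2 : R -> R[i], [/\ ac_derivC u u1, ac_derivC u1 u2 &
    {ae mu, forall x, 0 < x ->
      u2 x + (k ^+ 2)%:C * u x - (q x)%:C * u x = 0}].

Definition jost_solution q k u : Prop :=
  schrodinger_solution q k u /\
  cabs (u x - expi (k * x)) @[x --> +oo] --> (0 : R).

(* The equation is only imposed on x > 0, so f(0, k) is the limit at 0+. *)
Definition jost_function q F : Prop :=
  forall k, 0 < k -> exists u : R -> R[i],
    jost_solution q k u /\ cabs (u x - F k) @[x --> 0^'+] --> (0 : R).

Definition phase_shift q delta : Prop :=
  exists F : R -> R[i], [/\ jost_function q F,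
    (forall k, 0 < k -> F k = (cabs (F k))%:C * expi (- delta k)),
    (forall k, 0 < k -> {for k, continuous delta}) &
    delta k @[k --> +oo] --> (0 : R)].

End Defs.

(* Main.v *)
(* With s = ik the Jost solution is e^(sx) m(x,s), where m' = p, p' = q m - 2 s p and
   m -> 1, p -> 0 at infinity.  The decay of q makes the successive approximations, which
   are polynomials in s with real coefficients, converge locally uniformly in s, so m(x,.)
   and p(x,.) are entire.  Put N(x,s) = m1(x,-s) m2(x,s) - m1(x,s) m2(x,-s), an odd entire
   function of s.  Equality of the phase shifts gives N(0,ik) = 0 for k > 0, hence
   N(0,.) = 0 by the identity theorem.  For Re s <= 0 and |s| large, m1 and m2 are close to 1
   and a Gronwall estimate in x, starting from N(0,s) = 0, bounds N(x,s) independently of s;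
   by oddness and Liouville N(x,.) = 0 for every x >= 0.  Then the mixed Wronskian of
   the two Jost solutions plus 2s, again odd and entire, is 2s (m2 - m1) / m2, which is
   bounded on the half-plane, hence zero: m1 = m2.  Bound states never enter, because N and
   the mixed Wronskian involve no division by the Jost function. *)
Require Import Defs.
From mathcomp Require Import all_boot all_order all_algebra.
From mathcomp Require Import complex.
From mathcomp Require Import all_classical all_reals all_analysis.
From mathcomp Require Import measurable_realfun.
From mathcomp Require Import ring lra zify.
Set Implicit Arguments.
Unset Strict Implicit.
Unset Printing Implicit Defensive.
Import Order.TTheory GRing.Theory Num.Theory.
Import numFieldNormedType.Exports.
Local Open Scope classical_set_scope.
Local Open Scope ring_scope.

#[local] Arguments cabs : simpl never.

(** * Complex modulus and Cauchy's estimate *)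

(** For Re s <= 0 only m1(x,s) and m2(x,s) are bounded uniformly in s; no such bound is available
    for m1(x,-s) and m2(x,-s), yet N and the mixed Wronskian contain them. They are eliminated: in
    the differential equation for N by the Wronskian identity of each potential, in the mixed
    Wronskian by N = 0. What remains involves s (m2 - m1), which stays bounded because both
    functions are 1 + O(1/|s|). Analyticity is used without contour integrals: an entire function is
    here a locally uniform limit of polynomials with real coefficients. These limits are stable
    under ring operations and s -> -s. Cauchy's estimate becomes an average over roots of unity, and
    Liouville's theorem and the identity theorem follow from polynomial estimates whose constants do
    not depend on the approximating polynomial. Real coefficients also give F(conj s) = conj F(s),
    so that m(0,-ik) is the conjugate of the Jost function m(0,ik); this is how the phase enters. *)

Section ComplexModulus.
Context {R : realType}.
Implicit Types (z w : R[i]) (x y : R).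

Lemma cabsE z : cabs z = Num.sqrt (complex.Re z ^+ 2 + complex.Im z ^+ 2).
Proof. by case: z. Qed.

Lemma cabs_ge0 z : 0 <= cabs z. Proof. by rewrite cabsE sqrtr_ge0. Qed.

Lemma cabs_sqr z : cabs z ^+ 2 = complex.Re z ^+ 2 + complex.Im z ^+ 2.
Proof. by rewrite cabsE sqr_sqrtr // addr_ge0 ?sqr_ge0. Qed.

Lemma cabs0 : cabs (0 : R[i]) = 0.
Proof. by rewrite cabsE /= expr0n addr0 sqrtr0. Qed.

Lemma cabs0_eq z : cabs z = 0 -> z = 0.
Proof. exact: ComplexField.Normc.eq0_normc. Qed.

Lemma cabs1 : cabs (1 : R[i]) = 1.
Proof. by rewrite cabsE /= expr0n addr0 expr1n sqrtr1. Qed.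

Lemma cabsM z w : cabs (z * w) = cabs z * cabs w.
Proof. exact: ComplexField.Normc.normcM. Qed.

Lemma cabsV z : cabs z^-1 = (cabs z)^-1.
Proof. exact: ComplexField.Normc.normcV. Qed.

Lemma cabsX z n : cabs (z ^+ n) = cabs z ^+ n.
Proof. by elim: n => [|n IH]; rewrite ?expr0 ?cabs1 // !exprS cabsM IH. Qed.

Lemma cabsN z : cabs (- z) = cabs z.
Proof. by rewrite !cabsE; case: z => a b /=; rewrite !sqrrN. Qed.

Lemma cabsD z w : cabs (z + w) <= cabs z + cabs w.
Proof. exact: le_normcD. Qed.

Lemma cabsB z w : cabs (z - w) <= cabs z + cabs w.
Proof. by rewrite (le_trans (cabsD _ _)) // cabsN. Qed.

Lemma cabsBC z w : cabs (z - w) = cabs (w - z).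
Proof. by rewrite -cabsN opprB. Qed.

Lemma cabs_sub_trans u z w : cabs (z - w) <= cabs (z - u) + cabs (u - w).
Proof. by have := cabsD (z - u) (u - w); rewrite addrA subrK. Qed.

Lemma cabsR x : cabs x%:C%C = `|x|.
Proof. by rewrite cabsE /= expr0n addr0 sqrtr_sqr. Qed.

Lemma cabs_nat n : cabs (n%:R : R[i]) = n%:R.
Proof. by rewrite -(rmorph_nat (real_complex R)) cabsR normr_nat. Qed.

Lemma cabs_Re z : `|complex.Re z| <= cabs z.
Proof. by rewrite cabsE -sqrtr_sqr ler_wsqrtr // lerDl sqr_ge0. Qed.

Lemma cabs_Im z : `|complex.Im z| <= cabs z.
Proof. by rewrite cabsE -sqrtr_sqr ler_wsqrtr // lerDr sqr_ge0. Qed.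

Lemma cabs_le z : cabs z <= `|complex.Re z| + `|complex.Im z|.
Proof.
rewrite -(ler_pXn2r (n := 2)) ?nnegrE ?cabs_ge0 ?addr_ge0 //.
by rewrite cabs_sqr sqrrD !real_normK ?num_real// lerD2r lerDl mulrn_wge0 ?mulr_ge0.
Qed.

Lemma cabs_conj z : cabs (conjc z) = cabs z.
Proof. by rewrite !cabsE; case: z => a b /=; rewrite sqrrN. Qed.

Lemma cabs_gt0 z : (0 < cabs z) = (z != 0).
Proof.
rewrite lt_neqAle cabs_ge0 andbT eq_sym; congr (~~ _).
by apply/eqP/eqP => [/cabs0_eq //|->]; rewrite cabs0.
Qed.

Lemma cabs_sum (I : Type) (r : seq I) (P : pred I) (F : I -> R[i]) :
  cabs (\sum_(i <- r | P i) F i) <= \sum_(i <- r | P i) cabs (F i).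
Proof.
elim/big_rec2 : _ => [|i y1 y2 _ IH]; first by rewrite cabs0.
by rewrite (le_trans (cabsD _ _)) // lerD2l.
Qed.

Lemma cabs_small_eq0 z : (forall e, 0 < e -> cabs z <= e) -> z = 0.
Proof.
move=> h; apply: cabs0_eq; apply/eqP; rewrite eq_le cabs_ge0 andbT.
by apply/ler_addgt0Pr => e e0; rewrite add0r h.
Qed.

End ComplexModulus.

Section CauchyEstimate.
Context {R : realType}.
Local Notation C := R[i].

(** Extracting square roots k times from -1 gives w with w^(2^k) = -1, so its order divides 2^(k+1)
    but not 2^k. *)
Lemma exists_prim_root_pow2 (k : nat) :
  exists w : C, (2 ^ k.+1).-primitive_root w.
Proof.
have [w hw] : exists w : C, w ^+ (2 ^ k) = -1.
  elim: k => [|k [w hw]]; first by exists (-1); rewrite expr1.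
  by exists (sqrtc w); rewrite expnS exprM sqr_sqrtc.
have w1 : w ^+ (2 ^ k.+1) = 1 by rewrite expnSr exprM hw sqrrN expr1n.
have [m pm dm] := prim_order_exists (expn_gt0 2 k.+1) w1.
exists w; move: dm => /(dvdn_pfactor _ _ (isT : prime 2)) [l lk ml].
suff -> : (2 ^ k.+1 = m)%N by [].
rewrite ml; move: lk; rewrite leq_eqVlt => /orP[/eqP->//|]; rewrite ltnS => lk.
exfalso; have : w ^+ (2 ^ k) = 1.
  apply/eqP; rewrite -(prim_order_dvd pm) ml.
  by apply/dvdn_pfactor => //; exists l.
rewrite hw => /eqP; rewrite -subr_eq0 -opprD oppr_eq0.
by rewrite -[1 + 1]/(2%:R) pnatr_eq0.
Qed.

(** A discrete Fourier average over N-th roots of unity, N larger than n and the size of p, extracts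
    the coefficient exactly and replaces the contour integral. *)
Lemma cauchy_estimate (p : {poly C}) (r M : R) (n : nat) : 0 < r ->
  (forall z, cabs z = r -> cabs p.[z] <= M) -> cabs p`_n * r ^+ n <= M.
Proof.
move=> r0 hM.
have [w hw] := exists_prim_root_pow2 (maxn (size p) n).
set N := (2 ^ _)%N in hw.
have Nb : (maxn (size p) n < N)%N by rewrite /N (ltn_trans (ltnSn _)) // ltn_expl.
have N0 : (0 < N)%N by apply: leq_ltn_trans Nb.
have pN : (size p <= N)%N by rewrite (leq_trans (leq_maxl _ n)) // ltnW.
have nN : (n < N)%N by rewrite (leq_ltn_trans (leq_maxr (size p) n)).
have cw : cabs w = 1.
  apply/eqP; rewrite -(@pexpr_eq1 _ _ N) ?cabs_ge0 //.
  by rewrite -cabsX (prim_expr_order hw) cabs1.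
(* The exponent j (N - n) stands for -j n, so only the coefficient of index n survives
   orthogonality. *)
have key : \sum_(j < N) p.[r%:C%C * w ^+ j] * w ^+ (j * (N - n)) =
    N%:R * (p`_n * r%:C%C ^+ n).
  under eq_bigr => j _.
    rewrite (horner_coef_wide _ pN) mulr_suml.
    under eq_bigr => i _.
      rewrite exprMn -exprM mulrA -mulrA -exprD.
      have -> : (j * i + j * (N - n) = (i + (N - n)) * j)%N by rewrite mulnDl -!(mulnC j).
      rewrite exprM.
      over.
    over.
  rewrite exchange_big /= (bigD1 (Ordinal nN)) //=.
  rewrite [X in _ + X]big1 ?addr0.
    under eq_bigr do rewrite subnKC ?(ltnW nN) // (prim_expr_order hw) expr1n mulr1.
    by rewrite sumr_const card_ord mulr_natl.
  move=> i ine; rewrite -mulr_sumr; apply/eqP; rewrite mulf_eq0; apply/orP; right.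
  set v := w ^+ _.
  have v1 : v != 1.
    rewrite /v -(prim_order_dvd hw); apply/negP => /dvdnP[c hc].
    have iN := ltn_ord i.
    have : i != n :> nat by apply: contra ine => /eqP h; apply/eqP/val_inj.
    move=> /eqP ni; case: c hc => [|[|c]]; rewrite ?mul0n ?mul1n ?mulSn; first lia; first lia.
    by move: (c * N)%N => cN; lia.
  have : (v - 1) * (\sum_(i < N) v ^+ i) = 0.
    by rewrite -subrX1 /v exprAC (prim_expr_order hw) expr1n subrr.
  by move=> /eqP; rewrite mulf_eq0 subr_eq0 (negbTE v1).
have : cabs (N%:R * (p`_n * r%:C%C ^+ n)) <= N%:R * M.
  rewrite -key (le_trans (cabs_sum _ _ _)) //.
  rewrite mulr_natl -[N in M *+ N]card_ord -sumr_const ler_sum // => j _.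
  by rewrite cabsM cabsX cw expr1n mulr1 hM // cabsM cabsX cw expr1n mulr1 cabsR gtr0_norm.
rewrite !cabsM cabsX cabsR gtr0_norm //.
by rewrite cabs_nat ler_pM2l // ltr0n.
Qed.

End CauchyEstimate.

(** * Entire functions as locally uniform limits of real polynomials *)

Section Entire.
Context {R : realType}.
Local Notation C := R[i].
Implicit Types (F G : C -> C) (z : C).

Definition evalC (p : {poly R}) (z : C) : C := (map_poly (real_complex R) p).[z].

(** This describes the entire functions that are real on the real axis, as uniform limits of real
    polynomials on every disc. *)
Definition entire F := forall r e : R, 0 < e ->
  exists p : {poly R}, forall z, cabs z <= r -> cabs (F z - evalC p z) <= e.

Lemma evalCD p q z : evalC (p + q) z = evalC p z + evalC q z.
Proof. by rewrite /evalC rmorphD hornerD. Qed.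

Lemma evalCN p z : evalC (- p) z = - evalC p z.
Proof. by rewrite /evalC rmorphN hornerN. Qed.

Lemma evalCM p q z : evalC (p * q) z = evalC p z * evalC q z.
Proof. by rewrite /evalC rmorphM hornerM. Qed.

Lemma evalCX z : evalC 'X z = z.
Proof. by rewrite /evalC map_polyX hornerX. Qed.

Lemma evalCC (c : R) z : evalC c%:P z = c%:C%C.
Proof. by rewrite /evalC map_polyC hornerC. Qed.

Lemma evalC_conj p z : evalC p (conjc z) = conjc (evalC p z).
Proof.
elim/poly_ind: p => [|p c IH].
  by rewrite -polyC0 !evalCC /= oppr0.
by rewrite !evalCD !evalCM !evalCX !evalCC IH rmorphD rmorphM /= oppr0.
Qed.

Lemma evalC_bounded p (r : R) : exists B, forall z, cabs z <= r -> cabs (evalC p z) <= B.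
Proof.
elim/poly_ind: p => [|p c [B hB]].
  by exists 0 => z _; rewrite -polyC0 evalCC cabs0.
exists (B * r + `|c|) => z zr.
rewrite evalCD evalCM evalCX evalCC (le_trans (cabsD _ _)) // cabsR lerD2r cabsM.
by rewrite ler_pM ?cabs_ge0 ?hB.
Qed.

Lemma entire_bounded F (r : R) : entire F ->
  exists B, 0 < B /\ forall z, cabs z <= r -> cabs (F z) <= B.
Proof.
move=> /(_ r 1 ltr01) [p hp]; have [B hB] := evalC_bounded p r.
exists (`|B| + 1); split; first by rewrite ltr_wpDl.
move=> z zr; rewrite -[F z](subrK (evalC p z)) (le_trans (cabsD _ _)) // addrC.
by rewrite lerD ?hp // (le_trans (hB _ zr)) // ler_norm.
Qed.

Lemma entire_evalC p : entire (evalC p).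
Proof. by move=> r e e0; exists p => z _; rewrite subrr cabs0 ltW. Qed.

Lemma eq_entire F G : F =1 G -> entire F -> entire G.
Proof. by move=> FG hF r e e0; have [p hp] := hF r e e0; exists p => z /hp; rewrite FG. Qed.

Lemma entireX : entire id.
Proof. by apply: (@eq_entire (evalC 'X)) (entire_evalC 'X) => z; rewrite evalCX. Qed.

Lemma entireC (c : R) : entire (fun=> c%:C%C).
Proof. by apply: (@eq_entire (evalC c%:P)) (entire_evalC _) => z; rewrite evalCC. Qed.

Lemma entireN F : entire F -> entire (fun z => - F z).
Proof.
move=> hF r e e0; have [p hp] := hF r e e0; exists (- p) => z /hp.
by rewrite evalCN -opprD cabsN.
Qed.

Lemma entireD F G : entire F -> entire G -> entire (fun z => F z + G z).
Proof.
move=> hF hG r e e0; have e2 : 0 < e / 2 by rewrite divr_gt0.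
have [p hp] := hF r _ e2; have [q hq] := hG r _ e2; exists (p + q) => z zr.
rewrite evalCD opprD addrACA (le_trans (cabsD _ _)) // [e]splitr.
by rewrite lerD ?hp ?hq.
Qed.

Lemma entireB F G : entire F -> entire G -> entire (fun z => F z - G z).
Proof. by move=> hF hG; apply: entireD => //; exact: entireN. Qed.

Lemma entireM F G : entire F -> entire G -> entire (fun z => F z * G z).
Proof.
move=> hF hG r e e0.
have [B [B0 hB]] := entire_bounded r hF.
have e2 : 0 < e / (2 * B) by rewrite divr_gt0 // mulr_gt0.
have [q hq] := hG r _ e2.
have [D [D0 hD]] := entire_bounded r (entire_evalC q).
have e1 : 0 < e / (2 * D) by rewrite divr_gt0 // mulr_gt0.
have [p hp] := hF r _ e1; exists (p * q) => z zr.
have -> : F z * G z - evalC (p * q) z =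
  F z * (G z - evalC q z) + (F z - evalC p z) * evalC q z.
  by rewrite evalCM; ring.
have -> : e = B * (e / (2 * B)) + e / (2 * D) * D by field; rewrite !gt_eqF.
rewrite (le_trans (cabsD _ _)) // !cabsM.
by rewrite lerD // ler_pM ?cabs_ge0 ?hB ?hD ?hp ?hq.
Qed.

Lemma entire_opp F : entire F -> entire (fun z => F (- z)).
Proof.
move=> hF r e e0; have [p hp] := hF r e e0; exists (p \Po (- 'X)) => z zr.
have -> : evalC (p \Po (- 'X)) z = evalC p (- z).
  by rewrite /evalC map_comp_poly horner_comp -/(evalC _ _) -/(evalC (- 'X) z) evalCN evalCX.
by apply: hp; rewrite cabsN.
Qed.

Lemma entire_conj F z : entire F -> F (conjc z) = conjc (F z).
Proof.
move=> hF; apply/eqP; rewrite -subr_eq0; apply/eqP/cabs_small_eq0 => e e0.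
have e2 : 0 < e / 2 by rewrite divr_gt0.
have [p hp] := hF (cabs z) _ e2.
rewrite (le_trans (cabs_sub_trans (evalC p (conjc z)) _ _)) // [e]splitr lerD ?hp ?cabs_conj //.
by rewrite evalC_conj -rmorphB cabs_conj cabsBC hp.
Qed.

Lemma geometric_le2 (t : R) n : 0 <= t -> t <= 2^-1 -> \sum_(i < n) t ^+ i <= 2.
Proof.
move=> t0 t1; have h : (1 - t) * \sum_(i < n) t ^+ i <= 1.
  by rewrite -opprB mulNr -subrX1 opprB gerBl exprn_ge0.
have s0 : 0 <= \sum_(i < n) t ^+ i by rewrite sumr_ge0 // => i _; rewrite exprn_ge0.
nra.
Qed.

(** Cauchy bounds on the coefficients dominate the tail by a geometric series of ratio |z|/r <= 1/2,
    uniformly in the degree of [p]. *)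
Lemma horner_tail (p : {poly C}) (r B : R) z n : 0 < r ->
  (forall i, cabs p`_i * r ^+ i <= B) -> cabs z <= r / 2 ->
  cabs (p.[z] - \sum_(i < n) p`_i * z ^+ i) <= 2 * B * (cabs z / r) ^+ n.
Proof.
move=> r0 hB zr.
have t0 : 0 <= cabs z / r by rewrite divr_ge0 ?cabs_ge0 ?ltW.
have t1 : cabs z / r <= 2^-1 by rewrite ler_pdivrMr // mulrC.
rewrite (@horner_coef_wide _ (n + size p)) ?leq_addl // big_split_ord /= addrAC subrr add0r.
rewrite (le_trans (cabs_sum _ _ _)) //.
apply: (@le_trans _ _ (\sum_(i < size p) B * (cabs z / r) ^+ n * (cabs z / r) ^+ i)).
  apply: ler_sum => i _; rewrite cabsM cabsX -mulrA -exprD.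
  rewrite expr_div_n mulrA ler_pdivlMr ?exprn_gt0 // mulrAC.
  by rewrite ler_wpM2r ?exprn_ge0 ?cabs_ge0 // hB.
rewrite -mulr_sumr -[2 * B * _]mulrA mulrC.
apply: ler_wpM2r (geometric_le2 _ t0 t1).
by rewrite mulr_ge0 ?exprn_ge0 // (le_trans _ (hB 0)) // mulr_ge0 ?cabs_ge0 ?exprn_ge0 ?ltW.
Qed.

(** Liouville's theorem: an approximating polynomial is bounded by M + e on the circle of radius r,
    so its values at z and 0 differ by O(|z|/r). *)
Lemma bounded_entire_cst F M : entire F -> (forall z, cabs (F z) <= M) ->
  forall z, F z = F 0.
Proof.
move=> hF hM z; apply/eqP; rewrite -subr_eq0; apply/eqP/cabs_small_eq0 => e e0.
have M0 : 0 <= M by rewrite (le_trans (cabs_ge0 _) (hM 0)).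
have c0 := cabs_ge0 z.
(* The first term gives |z| <= r/2, the second makes the tail 2 (M + e) |z|/r at most e/3, and the
   last keeps r positive. *)
pose r := 2 * cabs z + 2 * (M + e) * cabs z * 3 / e + 1.
have r0 : 0 < r by rewrite ltr_wpDl // addr_ge0 ?mulr_ge0 ?invr_ge0 ?addr_ge0 // ltW.
have zr : cabs z <= r / 2.
  rewrite ler_pdivlMr // mulrC /r -addrA lerDl addr_ge0 // !mulr_ge0 ?invr_ge0 ?addr_ge0 //ltW //.
have zr1 : cabs z <= r by lra.
have e3 : 0 < e / 3 by rewrite divr_gt0.
have [p hp] := hF r _ e3.
have hB i : cabs (map_poly (real_complex R) p)`_i * r ^+ i <= M + e.
  apply: cauchy_estimate => // u ur.
  rewrite -/(evalC p u) -[evalC p u](subKr (F u)) (le_trans (cabsB _ _)) // lerD //.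
  by rewrite (le_trans (hp _ _)) ?ur //; lra.
have := horner_tail 1 r0 hB zr; rewrite big_ord_recl big_ord0 addr0 expr0 mulr1 expr1.
rewrite -horner_coef0 -!/(evalC p _) => tl.
have tl2 : 2 * (M + e) * (cabs z / r) <= e / 3.
  have : 2 * (M + e) * cabs z * 3 / e <= r by rewrite /r; lra.
  by rewrite ler_pdivrMr // mulrA ler_pdivrMr //; lra.
have h0 := hp 0; rewrite cabs0 (ltW r0) in h0; have {}h0 := h0 isT.
rewrite (le_trans (cabs_sub_trans (evalC p z) _ _)) //.
have h1 := cabs_sub_trans (evalC p 0) (evalC p z) (F 0).
have h2 := hp _ zr1; rewrite cabsBC in h0; lra.
Qed.

(* Oddness transports the half-plane bound to the other half-plane. *)
Lemma odd_entire_eq0 F (M r0 : R) : entire F -> (forall z, F (- z) = - F z) ->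
  (forall z, complex.Re z <= 0 -> r0 <= cabs z -> cabs (F z) <= M) ->
  forall z, F z = 0.
Proof.
move=> hF oddF hM.
have [B [B0 hB]] := entire_bounded r0 hF.
have bd z : cabs (F z) <= Num.max B M.
  rewrite le_max; have [zr|/ltW zr] := leP (cabs z) r0; first by rewrite hB.
  apply/orP; right; have [z0|/ltW z0] := leP (complex.Re z) 0; first by rewrite hM.
  by rewrite -[z]opprK oddF cabsN hM ?cabsN // raddfN oppr_le0.
move=> z; rewrite (bounded_entire_cst hF bd).
have := oddF 0; rewrite oppr0 => /eqP; rewrite -subr_eq0 opprK -mulr2n mulrn_eq0 /=.
by move=> /eqP.
Qed.

(** Quantitative identity theorem for polynomials. The tolerance d depends on M, n and e but not on
    p, so the statement survives approximation of an entire function. Radius 2 makes the whole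
    segment satisfy the condition |z| <= r/2 of [horner_tail]. *)
Lemma coef_small (M : R) n (e : R) : 0 < M -> 0 < e -> exists2 d, 0 < d &
  forall p : {poly C}, (forall i, cabs p`_i * 2 ^+ i <= M) ->
  (forall t : R, 0 < t -> t < 1 -> cabs p.[t%:C%C * 'i%C] <= d) ->
  forall i, (i < n)%N -> cabs p`_i <= e.
Proof.
move=> M0; elim: n e => [|n IH] e e0; first by exists 1.
(* At z = it the coefficient of index n is isolated from the value, the lower terms and the tail.
   This t makes the tail 2 M (t/2)^(n+1) at most e t^n / 3. *)
pose t := Num.min 2^-1 (e / (3 * M)).
have t0 : 0 < t by rewrite lt_min invr_gt0 ltr0n divr_gt0 // mulr_gt0.
have t12 : t <= 2^-1 by rewrite ge_min lexx.
have t1 : t < 1 by lra.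
have tn : 0 < t ^+ n by rewrite exprn_gt0.
have tM : M * t <= e / 3.
  have : t <= e / (3 * M) by rewrite ge_min lexx orbT.
  by rewrite !ler_pdivlMr ?mulr_gt0 //; lra.
(* The n lower terms then sum to at most e t^n / 3; n + 1 in the denominator avoids division by
   zero. *)
pose e' := Num.min e (e * t ^+ n / (3 * n.+1%:R)).
have e'0 : 0 < e' by rewrite lt_min e0 /= divr_gt0 ?mulr_gt0.
have [d d0 hd] := IH _ e'0.
exists (Num.min d (e * t ^+ n / 3)); first by rewrite lt_min d0 divr_gt0 ?mulr_gt0.
move=> p hM hp i; rewrite ltnS leq_eqVlt => /orP[/eqP ->{i}|ilt]; last first.
  rewrite (@le_trans _ _ e') ?ge_min ?lexx //; apply: hd => // u u0 u1.
  by rewrite (le_trans (hp _ u0 u1)) // ge_min lexx.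
have sm i : (i < n)%N -> cabs p`_i <= e * t ^+ n / (3 * n.+1%:R).
  move=> ilt; rewrite (@le_trans _ _ e') ?ge_min ?lexx ?orbT //; apply: hd => // u u0 u1.
  by rewrite (le_trans (hp _ u0 u1)) // ge_min lexx.
set z := (t%:C * 'i)%C.
have cz : cabs z = t.
  by rewrite cabsM cabsR cabsE /= expr0n add0r expr1n sqrtr1 mulr1 gtr0_norm.
have := @horner_tail p 2 M z n.+1 (ltr0Sn _ 1) hM; rewrite cz => /(_ _)/wrap[|tl].
  lra.
have pz : cabs p.[z] <= e * t ^+ n / 3 by rewrite (le_trans (hp _ t0 t1)) // ge_min lexx orbT.
have sn : cabs (\sum_(i < n) p`_i * z ^+ i) <= e * t ^+ n / 3.
  rewrite (le_trans (cabs_sum _ _ _)) //.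
  apply: (@le_trans _ _ (\sum_(i < n) e * t ^+ n / (3 * n.+1%:R))).
    apply: ler_sum => i _; rewrite cabsM cabsX cz.
    rewrite -[leRHS]mulr1 ler_pM ?cabs_ge0 ?exprn_ge0 ?(ltW t0) ?sm //.
    by rewrite exprn_ile1 // ltW.
  rewrite sumr_const card_ord -[leLHS]mulr_natr mulrAC ler_pdivrMr ?mulr_gt0 //.
  have -> : e * t ^+ n / 3 * (3 * n.+1%:R) = e * t ^+ n * n.+1%:R by field.
  by rewrite ler_wpM2l ?ler_nat // mulr_ge0 // ltW.
have : cabs (p`_n * z ^+ n) <= e * t ^+ n.
  have -> : p`_n * z ^+ n = p.[z] - \sum_(i < n) p`_i * z ^+ i
     - (p.[z] - \sum_(i < n.+1) p`_i * z ^+ i) by rewrite big_ord_recr /=; ring.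
  rewrite (le_trans (cabsB _ _)) //.
  have : 2 * M * (t / 2) ^+ n.+1 <= e * t ^+ n / 3.
    rewrite expr_div_n exprS [2 ^+ _]exprS.
    have i2 : (2 ^+ n)^-1 <= 1 :> R by rewrite invf_le1 ?exprn_gt0 // exprn_ege1 // ler1n.
    have -> : 2 * M * (t * t ^+ n / (2 * 2 ^+ n)) = (M * t) * t ^+ n * (2 ^+ n)^-1.
      by field; rewrite expf_neq0.
    have -> : e * t ^+ n / 3 = e / 3 * t ^+ n * 1 by ring.
    apply: ler_pM => //; rewrite ?invr_ge0 ?exprn_ge0 // ?mulr_ge0 ?(ltW M0) ?(ltW t0) ?(ltW tn) //.
    by rewrite ler_wpM2r // ltW.
  have := cabsB p.[z] (\sum_(i < n) p`_i * z ^+ i).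
  lra.
by rewrite cabsM cabsX cz ler_pM2r.
Qed.

(** At a given z the tail beyond some n is small by the Cauchy bounds, and [coef_small] makes the
    first n coefficients of a good enough approximation small as well. *)
Lemma entire_identity F : entire F ->
  (forall t : R, 0 < t -> t < 1 -> F (t%:C%C * 'i%C) = 0) -> forall z, F z = 0.
Proof.
move=> hF F0 z; apply: cabs_small_eq0 => e e0.
(* The disc has |z| <= r/2 for the tail estimate and r >= 2 for the coefficient bounds required by
   [coef_small]. *)
pose r := 2 * cabs z + 2.
have c0 := cabs_ge0 z.
have r2 : 2 <= r by rewrite /r; lra.
have r0 : 0 < r by lra.
have [B [B0 hB]] := entire_bounded r hF.
have [n hn] : exists n : nat, 2 * (B + 1) * (cabs z / r) ^+ n <= e / 3.
  pose k := Num.truncn (2 * (B + 1) * 3 / e); exists k.+1.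
  have kb : 2 * (B + 1) * 3 / e < k.+1%:R by rewrite truncnS_gt.
  have h1 : (cabs z / r) ^+ k.+1 <= (2^-1) ^+ k.+1.
    rewrite lerXn2r // ?nnegrE ?divr_ge0 ?invr_ge0 ?(ltW r0) //.
    by rewrite ler_pdivrMr // /r; lra.
  have h2 : (2^-1) ^+ k.+1 <= k.+1%:R^-1 :> R.
    by rewrite exprVn lef_pV2 ?posrE ?exprn_gt0 // -natrX ler_nat ltnW // ltn_expl.
  rewrite (@le_trans _ _ (2 * (B + 1) / k.+1%:R)) //.
    by apply: ler_wpM2l; [lra|exact: le_trans h1 h2].
  move: kb; rewrite ltr_pdivrMr // => kb.
  by rewrite ler_pdivrMr //; lra.
pose K := n%:R * (cabs z + 1) ^+ n + 1.
have K0 : 0 < K by rewrite ltr_wpDl // mulr_ge0 // exprn_ge0 // addr_ge0.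
have e3 : 0 < e / (3 * K) by rewrite divr_gt0 ?mulr_gt0.
have [d d0 hd] := coef_small n (ltr_wpDl (ltW B0) ltr01) e3.
(* One approximation serves three purposes: smallness on the segment, the coefficient bound B + 1,
   and closeness to F at z. *)
have dd : 0 < Num.min d (Num.min 1 (e / 3)) by rewrite !lt_min d0 ltr01 divr_gt0.
have [p hp] := hF r _ dd.
have hp1 u : cabs u <= r -> cabs (F u - evalC p u) <= d.
  by move=> /hp h; rewrite (le_trans h) // ge_min lexx.
have hp2 u : cabs u <= r -> cabs (F u - evalC p u) <= 1.
  by move=> /hp h; rewrite (le_trans h) // !ge_min lexx orbT.
have hp3 u : cabs u <= r -> cabs (F u - evalC p u) <= e / 3.
  by move=> /hp h; rewrite (le_trans h) // !ge_min lexx !orbT.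
set P := map_poly (real_complex R) p.
have hBr i : cabs P`_i * r ^+ i <= B + 1.
  apply: cauchy_estimate => // u ur.
  rewrite -/(evalC p u) -[evalC p u](subKr (F u)) (le_trans (cabsB _ _)) // lerD //.
    by rewrite hB ?ur.
  by rewrite hp2 ?ur.
have hB2 i : cabs P`_i * 2 ^+ i <= B + 1.
  rewrite (le_trans _ (hBr i)) // ler_wpM2l ?cabs_ge0 // lerXn2r // nnegrE ltW //.
have small i : (i < n)%N -> cabs P`_i <= e / (3 * K).
  apply: hd => // t t0 t1.
  have := hp1 (t%:C * 'i)%C; rewrite F0 // sub0r cabsN; apply.
  by rewrite cabsM cabsR cabsE /= expr0n add0r expr1n sqrtr1 mulr1 gtr0_norm //; lra.
have zr2 : cabs z <= r / 2 by rewrite /r; lra.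
have tl := horner_tail n r0 hBr zr2.
have hz := hp3 z; rewrite /r in hz; have {}hz : cabs (F z - P.[z]) <= e / 3 by apply: hz; lra.
have sn : cabs (\sum_(i < n) P`_i * z ^+ i) <= e / 3.
  rewrite (le_trans (cabs_sum _ _ _)) //.
  apply: (@le_trans _ _ (\sum_(i < n) e / (3 * K) * (cabs z + 1) ^+ n)).
    apply: ler_sum => i _; rewrite cabsM cabsX.
    rewrite ler_pM ?cabs_ge0 ?exprn_ge0 ?small //.
    rewrite (@le_trans _ _ ((cabs z + 1) ^+ i)) //.
      by rewrite lerXn2r ?nnegrE ?addr_ge0 // lerDl.
    by rewrite ler_weXn2l ?lerDr // ltnW.
  rewrite sumr_const card_ord -[leLHS]mulr_natl.
  have -> : n%:R * (e / (3 * K) * (cabs z + 1) ^+ n) = e / (3 * K) * (K - 1) by rewrite /K; ring.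
  rewrite mulrAC ler_pdivrMr ?mulr_gt0 //.
  have -> : e / 3 * (3 * K) = e * K by field.
  by rewrite ler_pM2l // gerBl.
have h1 := cabsD (F z - P.[z]) P.[z]; rewrite subrK in h1.
have h2 := cabsD (P.[z] - \sum_(i < n) P`_i * z ^+ i) (\sum_(i < n) P`_i * z ^+ i).
rewrite subrK in h2.
by rewrite (le_trans h1) // (le_trans (lerD hz (le_trans h2 (lerD (le_trans tl hn) sn)))) //; lra.
Qed.

End Entire.

(** * Primitives of bounded measurable functions *)

Section Primitive.
Context {R : realType}.
Local Notation mu := (@lebesgue_measure R).
Implicit Types (a b x y : R) (u v g h : R -> R).

Definition bounded_measurable a b g :=
  measurable_fun `[a, b] g /\ exists B, forall x, a <= x -> x <= b -> `|g x| <= B.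

(** Requiring a bounded derivative makes [u] Lipschitz and the class stable under products. The
    functions built from a bounded potential belong to it. *)
Definition primitive a b u g := bounded_measurable a b g /\
  forall x y, a <= x -> x <= y -> y <= b -> u y - u x = \int[mu]_(t in `[x, y]) g t.

Lemma bounded_measurable_integrable a b g x y : bounded_measurable a b g ->
  a <= x -> y <= b -> mu.-integrable `[x, y] (EFin \o g).
Proof.
move=> [mg [B hB]] ax yb.
have sub : `[x, y] `<=` `[a, b].
  by apply: subset_itv; rewrite bnd_simp.
have I : mu.-integrable `[a, b] (EFin \o g).
  apply: measurable_bounded_integrable => //.
    by rewrite /= lebesgue_measure_itv /=; case: ifPn => // _; rewrite -EFinB ltry.
  exists B; split; rewrite ?num_real // => M BM z /=; rewrite in_itv /= => /andP[az zb].
  by rewrite (le_trans (hB _ az zb)) // ltW.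
by apply: integrableS I => //; exact: measurable_itv.
Qed.

Lemma bounded_measurable_sub a b x y g : a <= x -> y <= b ->
  bounded_measurable a b g -> bounded_measurable x y g.
Proof.
move=> ax yb [mg [B hB]]; split.
  by apply: measurable_funS mg => //; apply: subset_itv; rewrite bnd_simp.
by exists B => z xz zy; apply: hB; [exact: le_trans xz|exact: le_trans yb].
Qed.

Lemma bounded_measurable_cst a b c : bounded_measurable a b (fun=> c).
Proof. by split; [exact: measurable_cst|exists `|c|]. Qed.

Lemma bounded_measurableD a b g h : bounded_measurable a b g ->
  bounded_measurable a b h -> bounded_measurable a b (fun x => g x + h x).
Proof.
move=> [mg [B hB]] [mh [D hD]]; split; first exact: measurable_funD.
by exists (B + D) => x ax xb; rewrite (le_trans (ler_normD _ _)) // lerD ?hB ?hD.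
Qed.

Lemma bounded_measurableM a b g h : bounded_measurable a b g ->
  bounded_measurable a b h -> bounded_measurable a b (fun x => g x * h x).
Proof.
move=> [mg [B hB]] [mh [D hD]]; split; first exact: measurable_funM.
by exists (B * D) => x ax xb; rewrite normrM ler_pM ?hB ?hD.
Qed.

Lemma bounded_measurableN a b g : bounded_measurable a b g ->
  bounded_measurable a b (fun x => - g x).
Proof.
move=> [mg [B hB]]; split; first exact: measurableT_comp.
by exists B => x ax xb; rewrite normrN hB.
Qed.

Lemma bounded_measurableB a b g h : bounded_measurable a b g ->
  bounded_measurable a b h -> bounded_measurable a b (fun x => g x - h x).
Proof. by move=> hg hh; apply: bounded_measurableD => //; exact: bounded_measurableN. Qed.

Lemma eq_bounded_measurable a b g h : (forall x, a <= x -> x <= b -> g x = h x) ->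
  bounded_measurable a b g -> bounded_measurable a b h.
Proof.
move=> gh [mg [B hB]]; split.
  apply: eq_measurable_fun mg => x /set_mem /=; rewrite in_itv /= => /andP[ax xb].
  exact: gh.
by exists B => x ax xb; rewrite -gh // hB.
Qed.

Lemma Rintegral_itv_split a b c g : mu.-integrable `[a, b] (EFin \o g) ->
  a <= c -> c <= b ->
  \int[mu]_(t in `[a, b]) g t = \int[mu]_(t in `[a, c]) g t + \int[mu]_(t in `[c, b]) g t.
Proof.
move=> ig ac cb.
have := @Rintegral_itvB R g (BLeft a) (BRight b) c ig.
rewrite !bnd_simp => /(_ ac cb) => h.
rewrite -[\int[mu]_(t in `[c, b]) _]Rintegral_itv_obnd_cbnd.
  by rewrite -h addrC subrK.
apply: integrableS ig => //=.
by apply: subset_itv; rewrite bnd_simp.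
Qed.

Lemma Rintegral_itv_cst x y c : x <= y -> \int[mu]_(t in `[x, y]) c = c * (y - x).
Proof.
move=> xy; rewrite Rintegral_cst //= lebesgue_measure_itv /= lte_fin.
case: ifPn => //= ; rewrite -leNgt => yx.
by rewrite (@le_anti _ _ x y) ?xy ?yx // subrr.
Qed.

Lemma Rintegral_itv_bound x y g B : x <= y -> bounded_measurable x y g ->
  (forall t, x <= t -> t <= y -> `|g t| <= B) ->
  `|\int[mu]_(t in `[x, y]) g t| <= B * (y - x).
Proof.
move=> xy mg hB; have ig := bounded_measurable_integrable mg (lexx x) (lexx y).
rewrite (le_trans (@le_normr_Rintegral _ _ _ mu _ _ _ ig)) //.
rewrite -Rintegral_itv_cst // le_Rintegral //.
- exact: integrable_norm ig.
- have := bounded_measurable_integrable (bounded_measurable_cst x y B) (lexx x) (lexx y).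
  by [].
- by move=> t /=; rewrite in_itv /= => /andP[xt ty]; apply: hB.
Qed.

Lemma primitive_sub a b x y u g : a <= x -> y <= b -> primitive a b u g -> primitive x y u g.
Proof.
move=> ax yb [bg ug]; split; first exact: bounded_measurable_sub bg.
by move=> s t xs st ty; apply: ug => //; [exact: le_trans xs|exact: le_trans yb].
Qed.

Lemma primitive_lip a b u g : primitive a b u g -> exists B, 0 <= B /\
  forall x y, a <= x -> x <= y -> y <= b -> `|u y - u x| <= B * (y - x).
Proof.
move=> [bg ug]; have [mg [B hB]] := bg; exists `|B|; split => // x y ax xy yb.
rewrite ug // Rintegral_itv_bound //.
  exact: bounded_measurable_sub bg.
move=> t xt ty; rewrite (le_trans _ (ler_norm B)) // hB //.
  exact: le_trans xt.
exact: le_trans yb.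
Qed.

Lemma lipschitz_bounded_measurable a b u B : 0 <= B ->
  (forall x y, a <= x -> x <= y -> y <= b -> `|u y - u x| <= B * (y - x)) ->
  bounded_measurable a b u.
Proof.
move=> B0 hu.
have lip x y : a <= x -> x <= b -> a <= y -> y <= b -> `|u y - u x| <= B * `|y - x|.
  move=> ax xb ay yb; have [xy|/ltW yx] := leP x y.
    by rewrite (ger0_norm (_ : 0 <= y - x)) ?subr_ge0 // hu.
  by rewrite distrC [X in B * X]distrC (ger0_norm (_ : 0 <= x - y)) ?subr_ge0 // hu.
split.
  (* Composing with the projection of the line onto [a, b] turns [u] into a continuous function on
     the whole line. *)
  pose cl x := Num.min b (Num.max a x).
  have [ab|ba] := leP a b; last first.
    by rewrite set_itv_ge ?bnd_simp -?ltNge //; exact: measurable_fun_set0.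
  have clb x : a <= cl x /\ cl x <= b.
    by rewrite /cl le_min ab le_max lexx /= ge_min lexx.
  have clL x y : `|cl y - cl x| <= `|y - x|.
    rewrite /cl; wlog xy : x y / x <= y.
      by move=> hw; have [/hw//|/ltW /hw] := leP x y; rewrite distrC [leRHS]distrC.
    rewrite (ger0_norm (_ : 0 <= y - x)) ?subr_ge0 //.
    rewrite ger0_norm ?subr_ge0; last first.
      by rewrite le_min ge_min lexx /= ge_min ge_max !le_max lexx xy !orbT.
    by rewrite /Num.min /Num.max; repeat case: ifPn; rewrite -?leNgt; lra.
  have : measurable_fun `[a, b] (u \o cl).
    apply: (@measurable_funS _ _ _ _ setT) => //.
    apply: continuous_measurable_fun => x; apply/cvgrPdist_le => e e0.
    near=> y => /=.
    have [c1 c2] := clb x; have [d1 d2] := clb y.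
    rewrite (le_trans (lip _ _ d1 d2 c1 c2)) // (le_trans (ler_wpM2l B0 (clL _ _))) //.
    have : `|x - y| <= e / (B + 1).
      near: y; apply/nbhs_ballP; exists (e / (B + 1)) => /=.
        by rewrite divr_gt0 // ltr_wpDl.
      by move=> z /= /ltW; rewrite /ball /=.
    rewrite ler_pdivlMr ?ltr_wpDl // => h; rewrite (le_trans _ h) // mulrC.
    by rewrite ler_wpM2l // lerDl.
  apply: eq_measurable_fun => x /set_mem /=; rewrite in_itv /= => /andP[ax xb].
  by rewrite /cl (max_idPr ax) (min_idPr xb).
exists (`|u a| + B * `|b - a|) => x ax xb.
have := lip a x (lexx a) (le_trans ax xb) ax xb.
have : `|u x| <= `|u a| + `|u x - u a| by rewrite -{1}[u x](subrKC (u a)) ler_normD.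
have : B * `|x - a| <= B * `|b - a|.
  by rewrite ler_wpM2l // !ger0_norm ?subr_ge0 ?lerD2r // (le_trans ax).
lra.
Unshelve. all: by end_near. Qed.

Lemma primitive_bounded_measurable a b u g : primitive a b u g -> bounded_measurable a b u.
Proof. by move=> /primitive_lip [B [B0 hB]]; exact: lipschitz_bounded_measurable hB. Qed.

Lemma primitive_cst a b c : primitive a b (fun=> c) (fun=> 0).
Proof.
split; first exact: bounded_measurable_cst.
by move=> x y ax xy yb; rewrite Rintegral_itv_cst // mul0r subrr.
Qed.

Lemma primitiveD a b u v g h : primitive a b u g -> primitive a b v h ->
  primitive a b (fun x => u x + v x) (fun x => g x + h x).
Proof.
move=> [bg ug] [bh vh]; split; first exact: bounded_measurableD.
move=> x y ax xy yb; rewrite RintegralD //; last 2 first.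
- exact: bounded_measurable_integrable bg ax yb.
- exact: bounded_measurable_integrable bh ax yb.
by rewrite -ug // -vh //; ring.
Qed.

Lemma primitiveN a b u g : primitive a b u g ->
  primitive a b (fun x => - u x) (fun x => - g x).
Proof.
move=> [bg ug]; split; first exact: bounded_measurableN.
move=> x y ax xy yb.
under eq_Rintegral do rewrite -mulN1r.
rewrite RintegralZl //; last exact: bounded_measurable_integrable bg ax yb.
by rewrite -ug //; ring.
Qed.

Lemma primitiveB a b u v g h : primitive a b u g -> primitive a b v h ->
  primitive a b (fun x => u x - v x) (fun x => g x - h x).
Proof. by move=> hu hv; apply: primitiveD => //; exact: primitiveN. Qed.

Lemma eq_primitive a b u v g h : (forall x, a <= x -> x <= b -> u x = v x) ->
  (forall x, a <= x -> x <= b -> g x = h x) -> primitive a b u g -> primitive a b v h.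
Proof.
move=> uv gh [bg ug]; split; first exact: eq_bounded_measurable bg.
move=> x y ax xy yb; rewrite -(uv _ ax (le_trans xy yb)) -(uv _ (le_trans ax xy) yb) ug //.
apply: eq_Rintegral => t /set_mem /=; rewrite in_itv /= => /andP[xt ty].
by apply: gh; [exact: le_trans xt|exact: le_trans yb].
Qed.

(** Over n + 1 equal subintervals the increments add up to at most C (b - a)^2 / (n + 1). *)
Lemma quadratic_modulus_cst a b (f : R -> R) (C : R) : a <= b ->
  (forall x y, a <= x -> x <= y -> y <= b -> `|f y - f x| <= C * (y - x) ^+ 2) ->
  f b = f a.
Proof.
move=> ab hf; apply/eqP; rewrite -subr_eq0 -normr_eq0 eq_le normr_ge0 andbT.
have step n : `|f b - f a| <= C * (b - a) ^+ 2 / n.+1%:R.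
  have N0 : n.+1%:R != 0 :> R by rewrite pnatr_eq0.
  pose x i := a + (b - a) * (i%:R / n.+1%:R).
  have x0 : x 0%N = a by rewrite /x mul0r mulr0 addr0.
  have xn : x n.+1 = b by rewrite /x divff // mulr1 subrKC.
  have xd i : x i.+1 - x i = (b - a) / n.+1%:R.
    by rewrite /x -[i.+1]addn1 natrD; move: (n.+1%:R) N0 => N N0; field.
  have xm i : x i <= x i.+1 by rewrite -subr_ge0 xd divr_ge0 ?subr_ge0.
  have xa i : a <= x i by rewrite /x lerDl mulr_ge0 ?subr_ge0 ?divr_ge0.
  have xb i : (i <= n.+1)%N -> x i <= b.
    move=> ile; rewrite -lerBrDl -[leRHS]mulr1 ler_wpM2l ?subr_ge0 //.
    by rewrite ler_pdivrMr ?ltr0n // mul1r ler_nat.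
  have -> : f b - f a = \sum_(0 <= i < n.+1) (f (x i.+1) - f (x i)).
    by rewrite telescope_sumr // x0 xn.
  rewrite big_mkord (le_trans (ler_norm_sum _ _ _)) //.
  apply: (@le_trans _ _ (\sum_(i < n.+1) C * ((b - a) / n.+1%:R) ^+ 2)).
    by apply: ler_sum => i _; rewrite -(xd i) hf // xb.
  rewrite sumr_const card_ord -[leLHS]mulr_natr.
  by move: (n.+1%:R) N0 => N N0; rewrite le_eqVlt; apply/orP; left; apply/eqP; field.
apply/ler_addgt0Pr => e e0; rewrite add0r.
pose k := Num.truncn (C * (b - a) ^+ 2 / e).
rewrite (le_trans (step k)) // ler_pdivrMr ?ltr0n // [leRHS]mulrC -ler_pdivrMr //.
by rewrite ltW // truncnS_gt.
Qed.

(** The defect between the product and the integral of its formal derivative has quadratically small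
    increments, hence is constant. This avoids differentiation almost everywhere. *)
Lemma primitiveM a b u v g h : primitive a b u g -> primitive a b v h ->
  primitive a b (fun x => u x * v x) (fun x => g x * v x + u x * h x).
Proof.
move=> pu pv.
have bu := primitive_bounded_measurable pu.
have bv := primitive_bounded_measurable pv.
have [bg ug] := pu; have [bh vh] := pv.
have bw : bounded_measurable a b (fun x => g x * v x + u x * h x).
  by apply: bounded_measurableD; exact: bounded_measurableM.
split => // x y ax xy yb.
have [Lu [Lu0 hLu]] := primitive_lip pu.
have [Lv [Lv0 hLv]] := primitive_lip pv.
have [_ [G hG]] := bg; have [_ [H hH]] := bh.
pose w t := g t * v t + u t * h t.
pose f z := u z * v z - \int[mu]_(t in `[x, z]) w t.
have : f y = f x.
  apply: (@quadratic_modulus_cst x y f (G * Lv + Lu * H)) => // s t xs st ty.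
  have as_ := le_trans ax xs; have tb := le_trans ty yb.
  (* From u(t)v(t) - u(s)v(s) = (u(t) - u(s)) v(t) + u(s) (v(t) - v(s)). Each term of the integrand
     is a bounded factor times a Lipschitz increment. *)
  have -> : f t - f s = \int[mu]_(r in `[s, t]) (g r * (v t - v r) + (u s - u r) * h r).
    have -> : (fun r => g r * (v t - v r) + (u s - u r) * h r) =
              (fun r => (g r * v t + h r * u s) - w r).
      by apply/funext => r; rewrite /w; ring.
    have ig := bounded_measurable_integrable bg as_ tb.
    have ih := bounded_measurable_integrable bh as_ tb.
    have bgc c : bounded_measurable a b (fun r => g r * c).
      by apply: bounded_measurableM => //; exact: bounded_measurable_cst.
    have bhc c : bounded_measurable a b (fun r => h r * c).
      by apply: bounded_measurableM => //; exact: bounded_measurable_cst.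
    rewrite RintegralB //; last 2 first.
    - exact: (bounded_measurable_integrable (bounded_measurableD (bgc _) (bhc _)) as_ tb).
    - exact: bounded_measurable_integrable bw as_ tb.
    rewrite RintegralD //; last 2 first.
    - exact: (bounded_measurable_integrable (bgc _) as_ tb).
    - exact: (bounded_measurable_integrable (bhc _) as_ tb).
    rewrite !RintegralZr // -ug // -vh // /f.
    rewrite (@Rintegral_itv_split x t s w) //; first by ring.
    exact: bounded_measurable_integrable bw ax tb.
  have G0 : 0 <= G by rewrite (le_trans (normr_ge0 (g s))) // hG // (le_trans st).
  have -> : (G * Lv + Lu * H) * (t - s) ^+ 2 = (G * Lv + Lu * H) * (t - s) * (t - s).
    by ring.
  apply: Rintegral_itv_bound => //.
    apply: bounded_measurable_sub as_ tb _; apply: bounded_measurableD.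
      apply: bounded_measurableM => //; apply: bounded_measurableB => //.
      exact: bounded_measurable_cst.
    apply: bounded_measurableM => //; apply: bounded_measurableB => //.
    exact: bounded_measurable_cst.
  move=> r sr rt; have ar := le_trans as_ sr; have rb := le_trans rt tb.
  rewrite (le_trans (ler_normD _ _)) // [leRHS]mulrDl !normrM.
  rewrite lerD //.
    rewrite -[G * Lv * _]mulrA ler_pM ?hG // (le_trans (hLv _ _ _ _ _)) //.
    by rewrite ler_wpM2l // lerD2l lerN2.
  rewrite mulrAC ler_pM ?hH // distrC (le_trans (hLu _ _ _ _ _)) //.
  by rewrite ler_wpM2l // lerD2r.
rewrite /f set_itv1 Rintegral_set1 subr0 => /eqP; rewrite subr_eq addrC -subr_eq => /eqP <-.
by [].
Qed.

Lemma primitive_ge0 a b u g : a <= b -> primitive a b u g ->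
  (forall x, a <= x -> x <= b -> 0 <= g x) -> u a <= u b.
Proof.
move=> ab [_ ug] g0; rewrite -subr_ge0 ug //; apply: Rintegral_ge0 => x /=.
by rewrite in_itv /= => /andP[]; exact: g0.
Qed.

Lemma primitive_eq0 a b u g : a <= b -> primitive a b u g ->
  (forall x, a <= x -> x <= b -> g x = 0) -> u a = u b.
Proof.
move=> ab [_ ug] g0; apply/eqP; rewrite eq_sym -subr_eq0 ug //.
rewrite (@eq_Rintegral _ _ _ _ _ (fun=> 0)); last first.
  by move=> x /set_mem /=; rewrite in_itv /= => /andP[ax xb]; rewrite g0.
by rewrite Rintegral_itv_cst // mul0r.
Qed.

End Primitive.

(** * Complex-valued primitives and the exponentials *)

Section ComplexPrimitive.
Context {R : realType}.
Local Notation C := R[i].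
Local Notation Re := (@complex.Re R).
Local Notation Im := (@complex.Im R).
Implicit Types (a b x y : R) (u v g h : R -> C).

Lemma cReM (z w : C) : Re (z * w) = Re z * Re w - Im z * Im w.
Proof. by case: z => ? ?; case: w. Qed.
Lemma cImM (z w : C) : Im (z * w) = Re z * Im w + Im z * Re w.
Proof. by case: z => ? ?; case: w. Qed.
Lemma cReD (z w : C) : Re (z + w) = Re z + Re w.
Proof. by case: z => ? ?; case: w. Qed.
Lemma cImD (z w : C) : Im (z + w) = Im z + Im w.
Proof. by case: z => ? ?; case: w. Qed.
Lemma cReN (z : C) : Re (- z) = - Re z. Proof. by case: z. Qed.
Lemma cImN (z : C) : Im (- z) = - Im z. Proof. by case: z. Qed.
Definition ReImE := (cReM, cImM, cReD, cImD, cReN, cImN).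

Lemma complex_ext (z w : C) : Re z = Re w -> Im z = Im w -> z = w.
Proof. by case: z => ? ?; case: w => ? ? /= -> ->. Qed.

Definition cprimitive a b u g :=
  primitive a b (fun x => Re (u x)) (fun x => Re (g x)) /\
  primitive a b (fun x => Im (u x)) (fun x => Im (g x)).

Lemma eq_cprimitive a b u v g h : (forall x, a <= x -> x <= b -> u x = v x) ->
  (forall x, a <= x -> x <= b -> g x = h x) -> cprimitive a b u g -> cprimitive a b v h.
Proof.
move=> uv gh [h1 h2]; split.
- by apply: eq_primitive h1 => x ax xb; rewrite ?uv ?gh.
- by apply: eq_primitive h2 => x ax xb; rewrite ?uv ?gh.
Qed.

Lemma cprimitive_cst a b (c : C) : cprimitive a b (fun=> c) (fun=> 0).
Proof. by split; exact: primitive_cst. Qed.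

Lemma cprimitiveD a b u v g h : cprimitive a b u g -> cprimitive a b v h ->
  cprimitive a b (fun x => u x + v x) (fun x => g x + h x).
Proof.
move=> [u1 u2] [v1 v2]; split.
- by apply: eq_primitive (primitiveD u1 v1) => x _ _; rewrite cReD.
- by apply: eq_primitive (primitiveD u2 v2) => x _ _; rewrite cImD.
Qed.

Lemma cprimitiveN a b u g : cprimitive a b u g ->
  cprimitive a b (fun x => - u x) (fun x => - g x).
Proof.
move=> [u1 u2]; split.
- by apply: eq_primitive (primitiveN u1) => x _ _; rewrite cReN.
- by apply: eq_primitive (primitiveN u2) => x _ _; rewrite cImN.
Qed.

Lemma cprimitiveB a b u v g h : cprimitive a b u g -> cprimitive a b v h ->
  cprimitive a b (fun x => u x - v x) (fun x => g x - h x).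
Proof. by move=> hu hv; apply: cprimitiveD => //; exact: cprimitiveN. Qed.

Lemma cprimitiveM a b u v g h : cprimitive a b u g -> cprimitive a b v h ->
  cprimitive a b (fun x => u x * v x) (fun x => g x * v x + u x * h x).
Proof.
move=> [u1 u2] [v1 v2]; split.
- apply: eq_primitive (primitiveB (primitiveM u1 v1)
    (primitiveM u2 v2)) => x _ _; rewrite !ReImE //; ring.
- apply: eq_primitive (primitiveD (primitiveM u1 v2)
    (primitiveM u2 v1)) => x _ _; rewrite !ReImE //; ring.
Qed.

Lemma cprimitiveZ a b (c : C) u g : cprimitive a b u g ->
  cprimitive a b (fun x => c * u x) (fun x => c * g x).
Proof.
move=> hu; apply: eq_cprimitive (cprimitiveM (cprimitive_cst a b c) hu) => x _ _ //.
by rewrite mul0r add0r.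
Qed.

Lemma cprimitive_eq0 a b u g : a <= b -> cprimitive a b u g ->
  (forall x, a <= x -> x <= b -> g x = 0) -> u a = u b.
Proof.
move=> ab [u1 u2] g0; apply: complex_ext.
- by apply: (primitive_eq0 ab u1) => x ax xb; rewrite g0.
- by apply: (primitive_eq0 ab u2) => x ax xb; rewrite g0.
Qed.

Lemma primitive_cabs_sqr a b u g : cprimitive a b u g ->
  primitive a b (fun x => cabs (u x) ^+ 2) (fun x => 2 * Re (conjc (u x) * g x)).
Proof.
move=> [u1 u2]; apply: eq_primitive (primitiveD
  (primitiveM u1 u1) (primitiveM u2 u2)) => x _ _.
  by rewrite cabs_sqr !expr2.
by case: (u x) => p q; case: (g x) => r s /=; ring.
Qed.

Lemma derive_primitive a b (u g : R -> R) : (forall x, is_derive x 1 u (g x)) ->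
  continuous g -> primitive a b u g.
Proof.
move=> du cg.
have cw c d : {within `[c, d], continuous g} by apply: continuous_subspaceT.
have bg : bounded_measurable a b g.
  split; first by apply: measurable_funS (continuous_measurable_fun cg).
  have [ab|ba] := leP a b; last by exists 0 => x ax xb; have := le_lt_trans (le_trans ax xb) ba; rewrite ltxx.
  have [c _ hc] := EVT_max ab (cw a b); have [d _ hd] := EVT_min ab (cw a b).
  exists (Num.max (g c) (- g d)) => x ax xb; rewrite ler_norml lerNl !le_max lerN2.
  by rewrite hc ?hd ?orbT ?in_itv /= ?ax.
split => // x y ax xy yb; move: xy; rewrite le_eqVlt => /orP[/eqP <-|xy].
  by rewrite subrr set_itv1 Rintegral_set1.
rewrite /Rintegral (@continuous_FTC2 R g u x y xy (cw x y)) //.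
- split => [t _||].
  + by have [] := du t.
  + by apply: cvg_at_right_filter; apply: differentiable_continuous; apply/derivable1_diffP; have [] := du x.
  + by apply: cvg_at_left_filter; apply: differentiable_continuous; apply/derivable1_diffP; have [] := du y.
- by move=> t _; rewrite derive1E; apply: derive_val.
Qed.

Lemma primitive_expR a b (l : R) :
  primitive a b (fun x => expR (l * x)) (fun x => l * expR (l * x)).
Proof.
apply: derive_primitive.
  by move=> x; apply: is_derive_eq; rewrite /GRing.scale /= mulr1 mulrC.
move=> x; apply: cvgM; first exact: cvg_cst.
apply: (@continuous_comp _ _ _ (fun x => l * x) expR); last exact: continuous_expR.
by apply: cvgM; [exact: cvg_cst|exact: cvg_id].
Qed.

Lemma cprimitive_expi a b (k : R) :
  cprimitive a b (fun x => expi (k * x)) (fun x => k%:C%C * 'i%C * expi (k * x)).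
Proof.
have ck : continuous (fun x : R => k * x).
  by move=> x; apply: cvgM; [exact: cvg_cst|exact: cvg_id].
split.
- apply: (@eq_primitive _ _ _ (fun x => cos (k * x)) _ (fun x => - k * sin (k * x))) => //.
    by move=> x _ _ /=; ring.
  apply: derive_primitive; first by move=> x; apply: is_derive_eq; rewrite /GRing.scale /=; ring.
  move=> x; apply: cvgM; first exact: cvg_cst.
  by apply: (@continuous_comp _ _ _ _ sin); [exact: ck|exact: continuous_sin].
- apply: (@eq_primitive _ _ _ (fun x => sin (k * x)) _ (fun x => k * cos (k * x))) => //.
    by move=> x _ _ /=; ring.
  apply: derive_primitive; first by move=> x; apply: is_derive_eq; rewrite /GRing.scale /=; ring.
  move=> x; apply: cvgM; first exact: cvg_cst.
  by apply: (@continuous_comp _ _ _ _ cos); [exact: ck|exact: continuous_cos].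
Qed.

End ComplexPrimitive.

(** * Tail integrals *)

Section TailIntegral.
Context {R : realType}.
Local Notation mu := (@lebesgue_measure R).
Implicit Types (a b x y l : R) (g h : R -> R).

Definition exp_decay l g :=
  measurable_fun setT g /\ exists A, forall x, `|g x| <= A * expR (- l * x).

(** At +oo this is decay faster than any exponential. The bound also holds at -oo, where it permits
    growth up to rate [l0]; m(x,s) may grow there at a rate depending on s. *)
Definition fast g := exists l0, forall l, l0 <= l -> exp_decay l g.

Definition tail h x := \int[mu]_(t in `[x, +oo[) h t.

Lemma exp_tail_continuous l : continuous (fun x : R => expR (- l * x)).
Proof.
move=> x; apply: (@continuous_comp _ _ _ (fun x => - l * x) expR).
  by apply: cvgM; [exact: cvg_cst|exact: cvg_id].
exact: continuous_expR.
Qed.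

Lemma expR_negM_cvg0 l : 0 < l -> expR (- l * x) @[x --> +oo] --> (0 : R).
Proof.
move=> l0; apply/cvgrPdist_le => e e0; near=> x.
rewrite sub0r normrN ger0_norm ?expR_ge0 // -[leRHS](lnK e0) ler_expR mulNr lerNl.
by rewrite -ler_pdivrMl //; near: x; exact: nbhs_pinfty_ge.
Unshelve. all: by end_near. Qed.

Lemma integral_exp_tail l x : 0 < l ->
  (\int[mu]_(t in `[x, +oo[) (expR (- l * t))%:E = (expR (- l * x) / l)%:E)%E.
Proof.
move=> l0.
have dF y : is_derive y (1 : R) (fun t => - (expR (- l * t) / l)) (expR (- l * y)).
  by apply: is_derive_eq; rewrite /GRing.scale /=; field; rewrite gt_eqF.
rewrite (@ge0_continuous_FTC2y R (fun t => expR (- l * t)) (fun t => - (expR (- l * t) / l)) x 0) //.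
- by rewrite -EFinB sub0r opprK.
- by apply: continuous_subspaceT; exact: exp_tail_continuous.
- have : - (expR (- l * t) / l) @[t --> +oo] --> - (0 / l).
    by apply: cvgN; apply: cvgM; [exact: expR_negM_cvg0|exact: cvg_cst].
  by rewrite mul0r oppr0.
- apply: cvg_at_right_filter.
  have cF : {for x, continuous (fun t => - (expR (- l * t) / l))}.
    by apply: differentiable_continuous; apply/derivable1_diffP; have [] := dF x.
  exact: cF.
- by move=> y _; rewrite derive1E; apply: derive_val.
Qed.

Lemma integrable_exp_tail l x : 0 < l ->
  mu.-integrable `[x, +oo[ (EFin \o (fun t => expR (- l * t))).
Proof.
move=> l0; apply/integrableP; split.
  apply/measurable_EFinP; apply: (@measurable_funS _ _ _ _ setT) => //.
  by apply: continuous_measurable_fun; exact: exp_tail_continuous.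
under eq_integral do rewrite /= ger0_norm ?expR_ge0 //.
by rewrite integral_exp_tail // ltry.
Qed.

Lemma integrable_scaled_exp_tail l A x : 0 < l ->
  mu.-integrable `[x, +oo[ (EFin \o (fun t => A * expR (- l * t))).
Proof.
move=> l0; have -> : EFin \o (fun t => A * expR (- l * t)) =
    (fun t => A%:E * (EFin \o (fun t => expR (- l * t))) t)%E by [].
by apply: integrableZl => //; exact: integrable_exp_tail.
Qed.

Lemma exp_decay_ge0 l g : exp_decay l g -> exists2 A, 0 <= A & forall x, `|g x| <= A * expR (- l * x).
Proof.
move=> [_ [A hA]]; exists A => //.
by have := le_trans (normr_ge0 _) (hA 0); rewrite mulr0 expR0 mulr1.
Qed.

Lemma exp_decay_integrable l g x : 0 < l -> exp_decay l g ->
  mu.-integrable `[x, +oo[ (EFin \o g).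
Proof.
move=> l0 hg; have [A A0 hA] := exp_decay_ge0 hg; have [mg _] := hg.
have I := integrable_scaled_exp_tail A x l0.
apply: le_integrable I => //.
  by apply/measurable_EFinP; exact: measurable_funS mg.
move=> t _ /=; rewrite lee_fin.
by rewrite [leRHS]ger0_norm ?hA // mulr_ge0 ?expR_ge0.
Qed.

Lemma tail_bound l g A x : 0 < l -> measurable_fun setT g ->
  (forall t, x <= t -> `|g t| <= A * expR (- l * t)) ->
  `|tail g x| <= A / l * expR (- l * x).
Proof.
move=> l0 mg hA.
have A0 : 0 <= A.
  by have := le_trans (normr_ge0 _) (hA x (lexx x)); rewrite pmulr_lge0 ?expR_gt0.
have ig : mu.-integrable `[x, +oo[ (EFin \o g).
  apply: le_integrable (integrable_scaled_exp_tail A x l0) => //.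
    by apply/measurable_EFinP; exact: measurable_funS mg.
  move=> t /=; rewrite in_itv /= andbT lee_fin => xt.
  by rewrite [leRHS]ger0_norm ?hA // mulr_ge0 ?expR_ge0.
rewrite (le_trans (@le_normr_Rintegral _ _ _ mu _ _ _ ig)) //.
have I := integrable_exp_tail x l0.
apply: (@le_trans _ _ (\int[mu]_(t in `[x, +oo[) (A * expR (- l * t)))).
  apply: le_Rintegral => //.
  - exact: integrable_norm ig.
  - exact: integrable_scaled_exp_tail.
  - by move=> t /=; rewrite in_itv /= andbT; exact: hA.
rewrite RintegralZl // /Rintegral integral_exp_tail //=.
by rewrite mulrA mulrAC.
Qed.

Lemma exp_decay_bounded_measurable l g a b : 0 < l -> exp_decay l g -> bounded_measurable a b g.
Proof.
move=> l0 hg; have [A A0 hA] := exp_decay_ge0 hg; have [mg _] := hg; split.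
  exact: measurable_funS mg.
exists (A * expR (- l * a)) => x ax xb; rewrite (le_trans (hA x)) // ler_wpM2l //.
by rewrite ler_expR !mulNr lerN2 ler_wpM2l // ltW.
Qed.

Lemma tail_primitive l g a b : 0 < l -> exp_decay l g ->
  primitive a b (tail g) (fun x => - g x).
Proof.
move=> l0 hg; have bg := exp_decay_bounded_measurable a b l0 hg.
split; first exact: bounded_measurableN.
move=> x y ax xy yb; rewrite /tail.
have := @Rintegral_itvB R g (BLeft x) (BInfty _ false) y (exp_decay_integrable x l0 hg).
rewrite !bnd_simp => /(_ xy isT).
rewrite Rintegral_itv_obnd_cbnd; last first.
  apply: integrableS (exp_decay_integrable y l0 hg) => //=.
  by apply: subset_itvr; rewrite bnd_simp.
move=> <-; under [RHS]eq_Rintegral do rewrite -mulN1r.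
rewrite RintegralZl //; last exact: bounded_measurable_integrable bg ax yb.
by rewrite mulN1r; ring.
Qed.

Lemma measurable_local (g : R -> R) : (forall n : nat, measurable_fun `[- (n%:R : R), (n%:R : R)] g) ->
  measurable_fun setT g.
Proof.
move=> hg; have -> : setT = \bigcup_n `[- (n%:R : R), (n%:R : R)]%classic.
  apply/seteqP; split => // x _; exists (Num.truncn `|x|).+1 => //=.
  by rewrite in_itv /= -ler_norml ltW // truncnS_gt.
by apply/measurable_fun_bigcup => // n; exact: measurable_itv.
Qed.

Lemma tail_exp_decay l g : 0 < l -> exp_decay l g -> exp_decay l (tail g).
Proof.
move=> l0 hg; split.
  apply: measurable_local => n.
  by have /primitive_bounded_measurable [] := tail_primitive (- n%:R) n%:R l0 hg.
have [A A0 hA] := exp_decay_ge0 hg; exists (A / l) => x.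
by apply: tail_bound => //; case: hg.
Qed.

Lemma exp_decayD l g h : exp_decay l g -> exp_decay l h -> exp_decay l (fun x => g x + h x).
Proof.
move=> [mg [A hA]] [mh [B hB]]; split; first exact: measurable_funD.
by exists (A + B) => x; rewrite (le_trans (ler_normD _ _)) // mulrDl lerD.
Qed.

Lemma exp_decayM l K (q g : R -> R) : measurable_fun setT q -> (forall x, `|q x| <= K) ->
  exp_decay l g -> exp_decay l (fun x => q x * g x).
Proof.
move=> mq hq [mg [A hA]]; split; first exact: measurable_funM.
by exists (K * A) => x; rewrite normrM -mulrA ler_pM.
Qed.

Lemma exp_decay0 l : exp_decay l (fun=> 0).
Proof. by split; [exact: measurable_cst|exists 0 => x; rewrite normr0 mul0r]. Qed.

Lemma tailD l g h x : 0 < l -> exp_decay l g -> exp_decay l h ->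
  tail (fun t => g t + h t) x = tail g x + tail h x.
Proof.
move=> l0 hg hh; rewrite /tail RintegralD //.
- exact: exp_decay_integrable l0 hg.
- exact: exp_decay_integrable l0 hh.
Qed.

Lemma tailZ l c g x : 0 < l -> exp_decay l g -> tail (fun t => c * g t) x = c * tail g x.
Proof.
by move=> l0 hg; rewrite /tail RintegralZl //; exact: exp_decay_integrable l0 hg.
Qed.

Lemma fastP g : fast g <-> exists2 l0, 0 < l0 & forall l, l0 <= l -> exp_decay l g.
Proof.
split=> [[l0 h]|[l0 _ h]]; last by exists l0.
exists (Num.max 1 l0); first by rewrite lt_max ltr01.
by move=> l; rewrite ge_max => /andP[_]; exact: h.
Qed.

Lemma fast_pos g : fast g -> exists2 l, 0 < l & exp_decay l g.
Proof. by move=> /fastP[l l0 h]; exists l => //; exact: h. Qed.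

Lemma fastD g h : fast g -> fast h -> fast (fun x => g x + h x).
Proof.
move=> [k hg] [l hh]; exists (Num.max k l) => m; rewrite ge_max => /andP[km lm].
by apply: exp_decayD; [exact: hg|exact: hh].
Qed.

Lemma fast_common g h : fast g -> fast h -> exists l, [/\ 0 < l, exp_decay l g & exp_decay l h].
Proof.
move=> /fastP [k k0 hg] [l hh]; exists (Num.max k l); split.
- by rewrite lt_max k0.
- by apply: hg; rewrite le_max lexx.
- by apply: hh; rewrite le_max lexx orbT.
Qed.

Lemma fastM K (q g : R -> R) : measurable_fun setT q -> (forall x, `|q x| <= K) ->
  fast g -> fast (fun x => q x * g x).
Proof. by move=> mq hq [l hg]; exists l => m lm; apply: exp_decayM => //; exact: hg. Qed.

Lemma fastZ (c : R) g : fast g -> fast (fun x => c * g x).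
Proof. by apply: (@fastM `|c| (fun=> c)) => //; exact: measurable_cst. Qed.

Lemma fast0 : fast (fun=> 0).
Proof. by exists 0 => l _; exact: exp_decay0. Qed.

Lemma fastN g : fast g -> fast (fun x => - g x).
Proof. by move=> /(fastZ (-1)); under eq_fun do rewrite mulN1r. Qed.

Lemma fast_tail g : fast g -> fast (tail g).
Proof.
move=> /fastP [l l0 h]; exists l => m lm.
by apply: tail_exp_decay; [exact: lt_le_trans lm|exact: h].
Qed.

End TailIntegral.

(** * Complex tail integrals *)

Section ComplexTail.
Context {R : realType}.
Local Notation C := R[i].
Local Notation Re := (@complex.Re R).
Local Notation Im := (@complex.Im R).
Implicit Types (h g : R -> C).

Definition cfast h := fast (fun x => Re (h x)) /\ fast (fun x => Im (h x)).

Definition ctail h x : C := (tail (fun t => Re (h t)) x +i* tail (fun t => Im (h t)) x)%C.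

#[local] Arguments ctail : simpl never.

Lemma cfastD h g : cfast h -> cfast g -> cfast (fun x => h x + g x).
Proof.
move=> [h1 h2] [g1 g2]; split.
- by under eq_fun do rewrite cReD; exact: fastD.
- by under eq_fun do rewrite cImD; exact: fastD.
Qed.

Lemma cfastN h : cfast h -> cfast (fun x => - h x).
Proof.
move=> [h1 h2]; split.
- by under eq_fun do rewrite cReN; exact: fastN.
- by under eq_fun do rewrite cImN; exact: fastN.
Qed.

Lemma cfastB h g : cfast h -> cfast g -> cfast (fun x => h x - g x).
Proof. by move=> hh hg; apply: cfastD => //; exact: cfastN. Qed.

Lemma cfastZ (c : C) h : cfast h -> cfast (fun x => c * h x).
Proof.
move=> [h1 h2]; split.
- have -> : (fun x => Re (c * h x)) = (fun x => Re c * Re (h x) + - (Im c * Im (h x))).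
    by apply/funext => x; rewrite cReM.
  by apply: fastD; [exact: fastZ|apply: fastN; exact: fastZ].
- have -> : (fun x => Im (c * h x)) = (fun x => Re c * Im (h x) + Im c * Re (h x)).
    by apply/funext => x; rewrite cImM.
  by apply: fastD; exact: fastZ.
Qed.

Lemma cfast0 : cfast (fun=> 0).
Proof. by split; exact: fast0. Qed.

Lemma cReRM (c : R) (z : C) : Re (c%:C%C * z) = c * Re z.
Proof. by rewrite cReM /= mul0r subr0. Qed.
Lemma cImRM (c : R) (z : C) : Im (c%:C%C * z) = c * Im z.
Proof. by rewrite cImM /= mul0r addr0. Qed.

Lemma cfast_qM K (q : R -> R) h : measurable_fun setT q -> (forall x, `|q x| <= K) ->
  cfast h -> cfast (fun x => (q x)%:C%C * h x).
Proof.
move=> mq hq [h1 h2]; split.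
- have -> : (fun x => Re ((q x)%:C%C * h x)) = (fun x => q x * Re (h x)).
    by apply/funext => x; rewrite cReRM.
  exact: fastM hq _.
- have -> : (fun x => Im ((q x)%:C%C * h x)) = (fun x => q x * Im (h x)).
    by apply/funext => x; rewrite cImRM.
  exact: fastM hq _.
Qed.

Lemma cfast_tail h : cfast h -> cfast (ctail h).
Proof. by move=> [h1 h2]; split => /=; exact: fast_tail. Qed.

Lemma ctailD h g x : cfast h -> cfast g -> ctail (fun t => h t + g t) x = ctail h x + ctail g x.
Proof.
move=> [h1 h2] [g1 g2]; apply: complex_ext; rewrite /ctail /=.
- by under eq_fun do rewrite cReD; have [l [l0 ? ?]] := fast_common h1 g1; exact: (tailD _ l0).
- by under eq_fun do rewrite cImD; have [l [l0 ? ?]] := fast_common h2 g2; exact: (tailD _ l0).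
Qed.

Lemma ctailZ (c : C) h x : cfast h -> ctail (fun t => c * h t) x = c * ctail h x.
Proof.
move=> [h1 h2]; have [l [l0 d1 d2]] := fast_common h1 h2.
have e1 k := exp_decayM (measurable_cst k) (fun=> lexx `|k|) d1.
have e2 k := exp_decayM (measurable_cst k) (fun=> lexx `|k|) d2.
apply: complex_ext; rewrite /ctail ?cReM ?cImM /=.
- have -> : (fun t => Re (c * h t)) = (fun t => Re c * Re (h t) + (- Im c) * Im (h t)).
    by apply/funext => t; rewrite cReM mulNr.
  by rewrite (tailD _ l0 (e1 _) (e2 _)) !(tailZ _ _ l0) // mulNr.
- have -> : (fun t => Im (c * h t)) = (fun t => Re c * Im (h t) + Im c * Re (h t)).
    by apply/funext => t; rewrite cImM.
  by rewrite (tailD _ l0 (e2 _) (e1 _)) !(tailZ _ _ l0).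
Qed.

Lemma ctailB h g x : cfast h -> cfast g -> ctail (fun t => h t - g t) x = ctail h x - ctail g x.
Proof.
move=> hh hg; rewrite ctailD //; last exact: cfastN.
congr (_ + _); rewrite -mulN1r -ctailZ //; congr (ctail _ x).
by apply/funext => t; rewrite mulN1r.
Qed.

Lemma ctail0 x : ctail (fun=> 0) x = 0.
Proof.
transitivity (0 * ctail (fun=> 0) x); last by rewrite mul0r.
rewrite -ctailZ; last exact: cfast0.
congr (ctail _ x).
by apply/funext => t; rewrite mul0r.
Qed.

(* The factor 2 comes from bounding real and imaginary parts separately. *)
Lemma ctail_bound l h A x : 0 < l -> cfast h ->
  (forall t, x <= t -> cabs (h t) <= A * expR (- l * t)) ->
  cabs (ctail h x) <= 2 * A / l * expR (- l * x).
Proof.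
move=> l0 [h1 h2] hA.
have m1 : measurable_fun setT (fun x => Re (h x)) by have [? _ []] := fast_pos h1.
have m2 : measurable_fun setT (fun x => Im (h x)) by have [? _ []] := fast_pos h2.
rewrite (le_trans (cabs_le _)) //=.
have b1 := tail_bound l0 m1 (fun t xt => le_trans (cabs_Re _) (hA t xt)).
have b2 := tail_bound l0 m2 (fun t xt => le_trans (cabs_Im _) (hA t xt)).
have -> : 2 * A / l * expR (- l * x) = A / l * expR (- l * x) + A / l * expR (- l * x) by ring.
exact: lerD.
Qed.

Lemma ctail_cprimitive h a b : cfast h -> cprimitive a b (ctail h) (fun x => - h x).
Proof.
move=> [h1 h2]; have [l [l0 d1 d2]] := fast_common h1 h2; split.
- by apply: eq_primitive (tail_primitive a b l0 d1) => x _ _; rewrite ?cReN.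
- by apply: eq_primitive (tail_primitive a b l0 d2) => x _ _; rewrite ?cImN.
Qed.

Lemma cfast_cabs h : cfast h -> exists2 l0, 0 < l0 & forall l, l0 <= l ->
  exists2 A, 0 <= A & forall x, cabs (h x) <= A * expR (- l * x).
Proof.
move=> [/fastP[k k0 h1] /fastP[l l0 h2]]; exists (Num.max k l); first by rewrite lt_max k0.
move=> m; rewrite ge_max => /andP[km lm].
have [A A0 hA] := exp_decay_ge0 (h1 _ km); have [B B0 hB] := exp_decay_ge0 (h2 _ lm).
exists (A + B); first exact: addr_ge0.
by move=> x; rewrite (le_trans (cabs_le _)) // mulrDl lerD.
Qed.

End ComplexTail.

(** * The Jost solution *)

Section GeometricLimit.
Context {R : realType}.
Local Notation C := R[i].

Lemma geometric_cvg (a : nat -> R) (B : R) :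
  (forall n, `|a n.+1 - a n| <= B / 2 ^+ n) ->
  a n @[n --> \oo] --> limn a /\ forall n, `|a n - limn a| <= 2 * B / 2 ^+ n.
Proof.
move=> h.
have i2 n : (2 : R) ^+ n != 0 by rewrite expf_neq0.
have B0 : 0 <= B by have := le_trans (normr_ge0 _) (h 0%N); rewrite expr0 divr1.
have step n k : `|a (n + k)%N - a n| <= 2 * B / 2 ^+ n - 2 * B / 2 ^+ (n + k).
  elim: k => [|k IH]; first by rewrite addn0 !subrr normr0.
  rewrite addnS; have := h (n + k)%N.
  have := ler_distD (a (n + k)%N) (a (n + k).+1) (a n).
  have -> : 2 * B / 2 ^+ (n + k).+1 = B / 2 ^+ (n + k) by rewrite exprS; field.
  have : 2 * B / 2 ^+ (n + k) = B / 2 ^+ (n + k) + B / 2 ^+ (n + k) by ring.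
  lra.
have step2 n m : (n <= m)%N -> `|a m - a n| <= 2 * B / 2 ^+ n.
  move=> nm; have := step n (m - n)%N; rewrite subnKC // => /le_trans; apply.
  by rewrite gerBl divr_ge0 ?exprn_ge0 // mulr_ge0.
have g0 : (fun n => 2 * B / 2 ^+ n) @ \oo --> (0 : R).
  have -> : (fun n => 2 * B / 2 ^+ n) = geometric (2 * B) (2^-1 : R).
    by apply/funext => n; rewrite /geometric /= exprVn.
  by apply: cvg_geometric; rewrite ger0_norm ?invr_ge0 // invf_lt1 // ltr1n.
have cva : cvgn a.
  (* Subtracting 2B/2^n adds B/2^n to each increment, which makes the sequence nondecreasing and
     reduces convergence to monotone convergence. *)
  have -> : a = (fun n => (a n - 2 * B / 2 ^+ n) + 2 * B / 2 ^+ n).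
    by apply/funext => n; rewrite subrK.
  apply: is_cvgD; last by apply/cvg_ex; exists 0.
  apply: nondecreasing_is_cvgn.
    apply/nondecreasing_seqP => n.
    have := h n; have -> : 2 * B / 2 ^+ n.+1 = B / 2 ^+ n by rewrite exprS; field.
    rewrite ler_norml => /andP[+ _].
    have -> : 2 * B / 2 ^+ n = B / 2 ^+ n + B / 2 ^+ n by ring.
    lra.
  exists (a 0%N + 2 * B) => _ [n _ <-].
  have := step2 0%N n isT; rewrite expr0 divr1 ler_norml => /andP[_ +].
  have : 0 <= 2 * B / 2 ^+ n by rewrite divr_ge0 ?exprn_ge0 // mulr_ge0.
  lra.
split => // n.
apply/ler_addgt0Pr => e e0.
have /cvgrPdist_le /(_ e e0) [N _ hN] : a @ \oo --> limn a by [].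
have h1 := hN (maxn N n) (leq_maxl _ _); have h2 := step2 n (maxn N n) (leq_maxr _ _).
rewrite distrC in h1; rewrite distrC in h2.
by have := ler_distD (a (maxn N n)) (a n) (limn a); lra.
Qed.

Definition clim (u : nat -> C) : C :=
  (limn (fun n => complex.Re (u n)) +i* limn (fun n => complex.Im (u n)))%C.

Lemma geometric_clim (u : nat -> C) (B : R) :
  (forall n, cabs (u n.+1 - u n) <= B / 2 ^+ n) ->
  [/\ complex.Re (u n) @[n --> \oo] --> complex.Re (clim u),
      complex.Im (u n) @[n --> \oo] --> complex.Im (clim u) &
      forall n, cabs (u n - clim u) <= 4 * B / 2 ^+ n].
Proof.
move=> h.
have [c1 h1] : complex.Re (u n) @[n --> \oo] --> complex.Re (clim u) /\
    forall n, `|complex.Re (u n) - complex.Re (clim u)| <= 2 * B / 2 ^+ n.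
  apply: geometric_cvg => n; rewrite -cReN -cReD; exact: le_trans (cabs_Re _) (h n).
have [c2 h2] : complex.Im (u n) @[n --> \oo] --> complex.Im (clim u) /\
    forall n, `|complex.Im (u n) - complex.Im (clim u)| <= 2 * B / 2 ^+ n.
  apply: geometric_cvg => n; rewrite -cImN -cImD; exact: le_trans (cabs_Im _) (h n).
split => // n; rewrite (le_trans (cabs_le _)) // cReD cImD cReN cImN.
have -> : 4 * B / 2 ^+ n = 2 * B / 2 ^+ n + 2 * B / 2 ^+ n by ring.
exact: lerD.
Qed.

End GeometricLimit.

(** * Construction by successive approximations *)

Section JostSolution.
Context {R : realType}.
Local Notation C := R[i].
Local Notation Re := (@complex.Re R).
Local Notation Im := (@complex.Im R).
Implicit Types (q : R -> R) (s : C) (x : R).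

(** The form in which the decay hypothesis is used: bounded on the whole line, with every
    exponential rate available pointwise. *)
Definition rapid_potential q := [/\ measurable_fun setT q,
  exists K, forall x, `|q x| <= K &
  forall l, 0 < l -> exists A, forall x, `|q x| <= A * expR (- l * x)].

(* Successive approximations for m' = p, p' = q m - 2 s p, m(oo) = 1, p(oo) = 0. *)
Fixpoint jost_iter q s (n : nat) : (R -> C) * (R -> C) :=
  if n is k.+1 then
    (fun x => 1 - ctail (jost_iter q s k).2 x,
     ctail (fun t => 2 * s * (jost_iter q s k).2 t - (q t)%:C%C * (jost_iter q s k).1 t))
  else (fun=> 1, fun=> 0).

(* e^(sx) jost_m q s x is the Jost solution f(x,k) for s = ik, and jost_p is the
   x-derivative of jost_m. *)
Definition jost_m q s x := clim (fun n => (jost_iter q s n).1 x).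
Definition jost_p q s x := clim (fun n => (jost_iter q s n).2 x).

Section FixedPotential.
Variables (q : R -> R) (hq : rapid_potential q).

Lemma rapid_cfast : cfast (fun x => (q x)%:C%C).
Proof.
have [mq _ dq] := hq; split => /=; last exact: fast0.
by exists 1 => l l1; split=> //; apply: dq; apply: lt_le_trans l1.
Qed.

Lemma rapid_cfastM (h : R -> C) : cfast h -> cfast (fun x => (q x)%:C%C * h x).
Proof. by have [mq [K hK] _] := hq; exact: cfast_qM. Qed.

Lemma rapid_cfastM1 (h : R -> C) : cfast (fun x => h x - 1) -> cfast (fun x => (q x)%:C%C * h x).
Proof.
move=> hh; have -> : (fun x => (q x)%:C%C * h x) =
    (fun x => (q x)%:C%C * (h x - 1) + (q x)%:C%C).
  by apply/funext => x; ring.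
by apply: cfastD; [exact: rapid_cfastM|exact: rapid_cfast].
Qed.

Lemma jost_iter_cfast s n : cfast (fun x => (jost_iter q s n).1 x - 1) /\
  cfast (jost_iter q s n).2.
Proof.
elim: n => [|n [IH1 IH2]] /=.
  by split; last exact: cfast0; under eq_fun do rewrite subrr; exact: cfast0.
split.
  under eq_fun do rewrite addrAC subrr sub0r.
  by apply: cfastN; exact: cfast_tail.
by apply: cfast_tail; apply: cfastB; [exact: cfastZ|exact: rapid_cfastM1].
Qed.

Lemma jost_iter_step s n x :
  ((jost_iter q s n.+2).1 x - (jost_iter q s n.+1).1 x =
     - ctail (fun t => (jost_iter q s n.+1).2 t - (jost_iter q s n).2 t) x) /\
  ((jost_iter q s n.+2).2 x - (jost_iter q s n.+1).2 x =
     ctail (fun t => 2 * s * ((jost_iter q s n.+1).2 t - (jost_iter q s n).2 t)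
       - (q t)%:C%C * ((jost_iter q s n.+1).1 t - (jost_iter q s n).1 t)) x).
Proof.
have [a1 a2] := jost_iter_cfast s n; have [b1 b2] := jost_iter_cfast s n.+1.
split.
  by rewrite ctailB // [LHS]/=; ring.
have -> : (fun t => 2 * s * ((jost_iter q s n.+1).2 t - (jost_iter q s n).2 t)
       - (q t)%:C%C * ((jost_iter q s n.+1).1 t - (jost_iter q s n).1 t)) =
  (fun t => (2 * s * (jost_iter q s n.+1).2 t - (q t)%:C%C * (jost_iter q s n.+1).1 t) -
   (2 * s * (jost_iter q s n).2 t - (q t)%:C%C * (jost_iter q s n).1 t)).
  by apply/funext => t; ring.
rewrite ctailB //; apply: cfastB; by [exact: cfastZ|exact: rapid_cfastM1].
Qed.

(** In the weighted norm sup |h(x)| e^(lx) a tail integral gains a factor 1/l, so for large l the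
    iteration contracts by 1/2, uniformly in |s| <= r and in x. *)
Lemma jost_iter_cauchy (r : R) : exists2 l0, 0 < l0 & forall l, l0 <= l ->
  exists2 A, 0 <= A & forall s n x, cabs s <= r ->
    cabs ((jost_iter q s n.+1).1 x - (jost_iter q s n).1 x) <= A / 2 ^+ n * expR (- l * x) /\
    cabs ((jost_iter q s n.+1).2 x - (jost_iter q s n).2 x) <= A / 2 ^+ n * expR (- l * x).
Proof.
have [mq [K hK] dq] := hq.
have K0 : 0 <= K by rewrite (le_trans (normr_ge0 (q 0))).
(* The Lipschitz constants of the two components are 1 and 2|r| + K. With the factor 2 of
   [ctail_bound], ratio 1/2 requires l to be at least four times each of them. *)
exists (4 * (2 * `|r| + K + 1)).
  by rewrite mulr_gt0 // ltr_wpDl // addr_ge0 // mulr_ge0.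
move=> l hl.
have r0 := normr_ge0 r; have l0 : 0 < l by lra.
have [A hA] := dq l l0.
have A0 : 0 <= A by have := le_trans (normr_ge0 _) (hA 0); rewrite mulr0 expR0 mulr1.
have D0 : 0 <= 2 * A / l by rewrite divr_ge0 ?mulr_ge0 // ltW.
exists (2 * A / l) => // s n x sr; elim: n x => [|n IH] x.
  have e0 : 0 <= 2 * A / l / 2 ^+ 0 * expR (- l * x) by rewrite mulr_ge0 ?expR_ge0 ?expr0 ?divr1.
  split; first by rewrite /= ctail0 subr0 subrr cabs0.
  rewrite /= subr0 expr0 divr1.
  have -> : (fun t => 2 * s * 0 - (q t)%:C%C * 1) = (fun t => - (q t)%:C%C : C).
    by apply/funext => t; rewrite mulr0 sub0r mulr1.
  apply: ctail_bound => //; first by apply: cfastN; exact: rapid_cfast.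
  by move=> t _; rewrite cabsN cabsR.
have [-> ->] := jost_iter_step s n x.
have [a1 a2] := jost_iter_cfast s n; have [b1 b2] := jost_iter_cfast s n.+1.
have a12 : cfast (fun t => (jost_iter q s n.+1).1 t - (jost_iter q s n).1 t).
  have -> : (fun t => (jost_iter q s n.+1).1 t - (jost_iter q s n).1 t) =
    (fun t => ((jost_iter q s n.+1).1 t - 1) - ((jost_iter q s n).1 t - 1)).
    by apply/funext => t; ring.
  exact: cfastB.
have p2 : 0 <= 2 * A / l / 2 ^+ n by rewrite divr_ge0 ?exprn_ge0.
have le2 c : 0 <= c -> 4 * c <= l ->
    2 * (c * (2 * A / l / 2 ^+ n)) / l * expR (- l * x) <= 2 * A / l / 2 ^+ n.+1 * expR (- l * x).
  move=> c0 cl; rewrite ler_wpM2r ?expR_ge0 // ler_pdivrMr //.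
  have -> : 2 * A / l / 2 ^+ n.+1 = 2 * A / l / 2 ^+ n / 2.
    by rewrite exprS [in LHS]invfM; ring.
  move: (2 * A / l / 2 ^+ n) p2 => D D0'; nra.
split.
  rewrite cabsN; apply: le_trans (le2 1 _ _); rewrite ?mul1r; last 2 first.
  - by [].
  - lra.
  apply: ctail_bound => //; first exact: cfastB.
  by move=> t _; have [] := IH t.
apply: le_trans (le2 (2 * `|r| + K) _ _); last 2 first.
- by rewrite addr_ge0 // mulr_ge0.
- lra.
apply: ctail_bound => //.
  by apply: cfastB; [apply: cfastZ; exact: cfastB|exact: rapid_cfastM].
move=> t _; have [i1 i2] := IH t; rewrite (le_trans (cabsB _ _)) //.
rewrite -[leRHS]mulrA [leRHS]mulrDl lerD // cabsM.
  rewrite ler_pM ?cabs_ge0 // cabsM.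
  have -> : cabs (2 : C) = 2 by exact: cabs_nat.
  by rewrite ler_wpM2l // (le_trans sr) // ler_norm.
by rewrite ler_pM ?cabs_ge0 // cabsR.
Qed.

Lemma jost_iter_cvg (r : R) : exists2 l0, 0 < l0 & forall l, l0 <= l ->
  exists2 A, 0 <= A & forall s n x, cabs s <= r ->
    cabs ((jost_iter q s n).1 x - jost_m q s x) <= A / 2 ^+ n * expR (- l * x) /\
    cabs ((jost_iter q s n).2 x - jost_p q s x) <= A / 2 ^+ n * expR (- l * x).
Proof.
have [l0 l0p h] := jost_iter_cauchy r; exists l0 => // l ll.
have [A A0 hA] := h l ll; exists (4 * A); first by rewrite mulr_ge0.
move=> s n x sr.
have E (D : R) k : D / 2 ^+ k * expR (- l * x) = D * expR (- l * x) / 2 ^+ k by rewrite mulrAC.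
have [_ _ h1] : _ := @geometric_clim R (fun n => (jost_iter q s n).1 x) (A * expR (- l * x))
  (fun k => eq_ind _ (fun z => cabs _ <= z) (proj1 (hA s k x sr)) _ (E A k)).
have [_ _ h2] : _ := @geometric_clim R (fun n => (jost_iter q s n).2 x) (A * expR (- l * x))
  (fun k => eq_ind _ (fun z => cabs _ <= z) (proj2 (hA s k x sr)) _ (E A k)).
by split; rewrite E -[4 * A * _]mulrA.
Qed.

Lemma jost_measurable s :
  [/\ measurable_fun setT (fun x => Re (jost_m q s x)),
      measurable_fun setT (fun x => Im (jost_m q s x)),
      measurable_fun setT (fun x => Re (jost_p q s x)) &
      measurable_fun setT (fun x => Im (jost_p q s x))].
Proof.
have [l _ h] := jost_iter_cauchy (cabs s).
have [A A0 hA] := h l (lexx l).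
have E x (D : R) k : D / 2 ^+ k * expR (- l * x) = D * expR (- l * x) / 2 ^+ k by rewrite mulrAC.
have h1 x := @geometric_clim R (fun n => (jost_iter q s n).1 x) (A * expR (- l * x))
  (fun k => eq_ind _ (fun z => cabs _ <= z) (proj1 (hA s k x (lexx _))) _ (E x A k)).
have h2 x := @geometric_clim R (fun n => (jost_iter q s n).2 x) (A * expR (- l * x))
  (fun k => eq_ind _ (fun z => cabs _ <= z) (proj2 (hA s k x (lexx _))) _ (E x A k)).
have m1 n : measurable_fun setT (fun x => Re ((jost_iter q s n).1 x)).
  have [[/fast_pos [? _ [m _]] _] _] := jost_iter_cfast s n.
  have -> : (fun x => Re ((jost_iter q s n).1 x)) = (fun x => Re ((jost_iter q s n).1 x - 1) + 1).
    by apply/funext => x; rewrite cReD cReN /= subrK.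
  by apply: measurable_funD => //; exact: measurable_cst.
have m2 n : measurable_fun setT (fun x => Im ((jost_iter q s n).1 x)).
  have [[_ /fast_pos [? _ [m _]]] _] := jost_iter_cfast s n.
  have -> // : (fun x => Im ((jost_iter q s n).1 x)) = (fun x => Im ((jost_iter q s n).1 x - 1)).
    by apply/funext => x; rewrite cImD cImN /= subr0.
have m3 n : measurable_fun setT (fun x => Re ((jost_iter q s n).2 x)).
  by have [_ [/fast_pos [? _ [m _]] _]] := jost_iter_cfast s n.
have m4 n : measurable_fun setT (fun x => Im ((jost_iter q s n).2 x)).
  by have [_ [_ /fast_pos [? _ [m _]]]] := jost_iter_cfast s n.
split.
- by apply: (@measurable_fun_cvg _ _ _ _ (fun n x => Re ((jost_iter q s n).1 x))) => // x _; have [] := h1 x.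
- by apply: (@measurable_fun_cvg _ _ _ _ (fun n x => Im ((jost_iter q s n).1 x))) => // x _; have [] := h1 x.
- by apply: (@measurable_fun_cvg _ _ _ _ (fun n x => Re ((jost_iter q s n).2 x))) => // x _; have [] := h2 x.
- by apply: (@measurable_fun_cvg _ _ _ _ (fun n x => Im ((jost_iter q s n).2 x))) => // x _; have [] := h2 x.
Qed.

Lemma jost_cfast s : cfast (fun x => jost_m q s x - 1) /\ cfast (jost_p q s).
Proof.
have [l l0 h] := jost_iter_cvg (cabs s); have [m1 m2 m3 m4] := jost_measurable s.
have b k : l <= k -> exists A, forall x,
    cabs (jost_m q s x - 1) <= A * expR (- k * x) /\ cabs (jost_p q s x) <= A * expR (- k * x).
  move=> lk; have [A A0 hA] := h k lk; exists A => x.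
  (* The iterate of index 0 is (1, 0), so the rate of convergence from it is itself the decay of m -
     1 and p. *)
  have [] := hA s 0%N x (lexx _); rewrite /= expr0 divr1 => h1 h2.
  by rewrite cabsBC; split => //; rewrite -cabsN -sub0r.
split; split; exists l => k /b [A hA]; split.
- under eq_fun do rewrite cReD; apply: measurable_funD => //; exact: measurable_cst.
- by exists A => x; rewrite (le_trans (cabs_Re _)) //; have [] := hA x.
- under eq_fun do rewrite cImD; apply: measurable_funD => //; exact: measurable_cst.
- by exists A => x; rewrite (le_trans (cabs_Im _)) //; have [] := hA x.
- by [].
- by exists A => x; rewrite (le_trans (cabs_Re _)) //; have [] := hA x.
- by [].
- by exists A => x; rewrite (le_trans (cabs_Im _)) //; have [] := hA x.
Qed.

Lemma inv_pow2_small (B e : R) : 0 < e -> exists n, B / 2 ^+ n <= e.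
Proof.
move=> e0; exists (Num.truncn (B / e)).+1; rewrite ler_pdivrMr ?exprn_gt0 //.
have : B / e < (Num.truncn (B / e)).+1%:R by rewrite truncnS_gt.
rewrite ltr_pdivrMr // => /ltW /le_trans; apply; rewrite mulrC ler_wpM2l ?(ltW e0) //.
by rewrite -natrX ler_nat ltnW // ltn_expl.
Qed.

Lemma eq_of_geometric_bound (z w : C) (B : R) :
  (forall n, cabs (z - w) <= B / 2 ^+ n) -> z = w.
Proof.
move=> h; apply/eqP; rewrite -subr_eq0; apply/eqP/cabs_small_eq0 => e e0.
by have [n hn] := inv_pow2_small B e0; exact: le_trans (h n) hn.
Qed.

(** The limit passes through the tail integrals because the errors are O(2^-n) with an exponential
    weight. Both sides are compared with iterate n + 1. *)
Lemma jost_equations s x :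
  jost_m q s x = 1 - ctail (jost_p q s) x /\
  jost_p q s x = ctail (fun t => 2 * s * jost_p q s t - (q t)%:C%C * jost_m q s t) x.
Proof.
have [mq [K hK] dq] := hq.
have K0 : 0 <= K by rewrite (le_trans (normr_ge0 (q 0))).
have [l l0 h] := jost_iter_cvg (cabs s); have [A A0 hA] := h l (lexx l).
have [c1 c2] := jost_cfast s.
have e0 := expR_ge0 (- l * x).
have half n : A / 2 ^+ n.+1 * expR (- l * x) <= A / 2 ^+ n * expR (- l * x).
  rewrite ler_wpM2r // ler_wpM2l // lef_pV2 ?posrE ?exprn_gt0 //.
  by rewrite exprS ler_peMl ?exprn_ge0 // ler1n.
split.
- apply: (@eq_of_geometric_bound _ _ ((A + 2 * A / l) * expR (- l * x))) => n.
  have [d1 d2] := jost_iter_cfast s n.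
  have -> : jost_m q s x - (1 - ctail (jost_p q s) x) =
      ctail (fun t => jost_p q s t - (jost_iter q s n).2 t) x
      - ((jost_iter q s n.+1).1 x - jost_m q s x).
    rewrite (ctailB x c2 d2).
    have -> : (jost_iter q s n.+1).1 x = 1 - ctail (jost_iter q s n).2 x by [].
    by move: (ctail _ x) (ctail _ x) (jost_m q s x) => a b c; ring.
  rewrite (le_trans (cabsB _ _)) //.
  have b : cabs (ctail (fun t => jost_p q s t - (jost_iter q s n).2 t) x) <=
      2 * (A / 2 ^+ n) / l * expR (- l * x).
    apply: ctail_bound => //; first exact: cfastB.
    by move=> t _; rewrite cabsBC; have [] := hA s n t (lexx _).
  have [h1 _] := hA s n.+1 x (lexx _).
  rewrite (le_trans (lerD b (le_trans h1 (half n)))) //.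
  by rewrite le_eqVlt; apply/orP; left; apply/eqP; ring.
- apply: (@eq_of_geometric_bound _ _ ((A + 2 * ((2 * cabs s + K) * A) / l) * expR (- l * x))) => n.
  have [d1 d2] := jost_iter_cfast s n.
  have dm : cfast (fun t => jost_m q s t - (jost_iter q s n).1 t).
    have -> : (fun t => jost_m q s t - (jost_iter q s n).1 t) =
      (fun t => (jost_m q s t - 1) - ((jost_iter q s n).1 t - 1)).
      by apply/funext => t; ring.
    exact: cfastB.
  pose g t := 2 * s * (jost_p q s t - (jost_iter q s n).2 t)
      - (q t)%:C%C * (jost_m q s t - (jost_iter q s n).1 t).
  have cg : cfast g.
    by apply: cfastB; [apply: cfastZ; exact: cfastB|exact: rapid_cfastM].
  have -> : jost_p q s x - ctail (fun t => 2 * s * jost_p q s t - (q t)%:C%C * jost_m q s t) x =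
    - ctail g x - ((jost_iter q s n.+1).2 x - jost_p q s x).
    have -> : g = (fun t => (2 * s * jost_p q s t - (q t)%:C%C * jost_m q s t) -
       (2 * s * (jost_iter q s n).2 t - (q t)%:C%C * (jost_iter q s n).1 t)).
      by apply/funext => t; rewrite /g; ring.
    have -> : (jost_iter q s n.+1).2 x =
      ctail (fun t => 2 * s * (jost_iter q s n).2 t - (q t)%:C%C * (jost_iter q s n).1 t) x by [].
    rewrite [in RHS]ctailB; first by move: (ctail _ x) (ctail _ x) (jost_p q s x) => a b c; ring.
      by apply: cfastB; [exact: cfastZ|exact: rapid_cfastM1].
    by apply: cfastB; [exact: cfastZ|exact: rapid_cfastM1].
  rewrite (le_trans (cabsB _ _)) // cabsN.
  have b : cabs (ctail g x) <= 2 * ((2 * cabs s + K) * (A / 2 ^+ n)) / l * expR (- l * x).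
    apply: ctail_bound => // t _; have [i1 i2] := hA s n t (lexx _).
    rewrite (le_trans (cabsB _ _)) // -[leRHS]mulrA [leRHS]mulrDl lerD // cabsM.
      rewrite ler_pM ?cabs_ge0 // 1?cabsM; last by rewrite cabsBC.
      by have -> : cabs (2 : C) = 2 by exact: cabs_nat.
    by rewrite ler_pM ?cabs_ge0 // ?cabsR // cabsBC.
  have [_ h1] := hA s n.+1 x (lexx _).
  rewrite (le_trans (lerD b (le_trans h1 (half n)))) //.
  by rewrite le_eqVlt; apply/orP; left; apply/eqP; ring.
Qed.

End FixedPotential.
End JostSolution.

(** * Analyticity in the spectral parameter *)

Section JostEntire.
Context {R : realType}.
Local Notation C := R[i].
Variables (q : R -> R) (hq : rapid_potential q).

(** Finite sums of terms c(x) s^i with real fast c. An inductive predicate lets closure under every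
    operation of [jost_iter] be proved term by term. *)
Inductive polynomial_family : (C -> R -> C) -> Prop :=
| Polynomial_family0 : polynomial_family (fun _ _ => 0)
| Polynomial_familyS h c i : polynomial_family h -> fast c ->
    polynomial_family (fun s x => h s x + (c x)%:C%C * s ^+ i).

Lemma polynomial_family_evalC h x : polynomial_family h ->
  exists P, forall s, h s x = evalC P s.
Proof.
elim=> [|{}h c i _ [P hP] _]; first by exists 0 => s; rewrite -polyC0 evalCC.
exists (P + (c x)%:P * 'X^i) => s; rewrite hP evalCD evalCM evalCC.
by rewrite /evalC map_polyXn hornerXn.
Qed.

Lemma cfast_monomial (c : R -> R) (z : C) : fast c -> cfast (fun x => (c x)%:C%C * z).
Proof.
move=> hc; have -> : (fun x => (c x)%:C%C * z) = (fun x => z * (c x)%:C%C).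
  by apply/funext => x; rewrite mulrC.
by apply: cfastZ; split => //=; exact: fast0.
Qed.

Lemma polynomial_family_cfast h s : polynomial_family h -> cfast (h s).
Proof.
by elim=> [|{}h c i _ IH hc]; [exact: cfast0|apply: cfastD => //; exact: cfast_monomial].
Qed.

Lemma polynomial_familyD g h : polynomial_family g -> polynomial_family h ->
  polynomial_family (fun s x => g s x + h s x).
Proof.
move=> hg; elim=> [|{}h c i _ IH hc].
  by under eq_fun do under eq_fun do rewrite addr0.
by under eq_fun do under eq_fun do rewrite addrA; exact: Polynomial_familyS.
Qed.

Lemma polynomial_familyX h : polynomial_family h -> polynomial_family (fun s x => s * h s x).
Proof.
elim=> [|{}h c i _ IH hc].
  by under eq_fun do under eq_fun do rewrite mulr0; exact: Polynomial_family0.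
have -> : (fun s x => s * (h s x + (c x)%:C%C * s ^+ i)) =
    (fun s x => s * h s x + (c x)%:C%C * s ^+ i.+1).
  by apply/funext => s; apply/funext => x; rewrite exprS; ring.
exact: Polynomial_familyS.
Qed.

Lemma polynomial_familyM K (a : R -> R) h : measurable_fun setT a -> (forall x, `|a x| <= K) ->
  polynomial_family h -> polynomial_family (fun s x => (a x)%:C%C * h s x).
Proof.
move=> ma ha; elim=> [|{}h c i _ IH hc].
  by under eq_fun do under eq_fun do rewrite mulr0; exact: Polynomial_family0.
have -> : (fun s x => (a x)%:C%C * (h s x + (c x)%:C%C * s ^+ i)) =
    (fun s x => (a x)%:C%C * h s x + (a x * c x)%:C%C * s ^+ i).
  by apply/funext => s; apply/funext => x; rewrite rmorphM /= mulrDr mulrA.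
by apply: Polynomial_familyS => //; exact: fastM ha _.
Qed.

Lemma polynomial_familyZ (k : R) h : polynomial_family h ->
  polynomial_family (fun s x => k%:C%C * h s x).
Proof. by apply: (@polynomial_familyM `|k| (fun=> k)) => //; exact: measurable_cst. Qed.

Lemma polynomial_familyN h : polynomial_family h -> polynomial_family (fun s x => - h s x).
Proof.
move=> /(polynomial_familyZ (-1)).
by under eq_fun do under eq_fun do rewrite rmorphN1 mulN1r.
Qed.

Lemma ctail_real (c : R -> R) x : ctail (fun t => (c t)%:C%C) x = (tail c x)%:C%C.
Proof.
apply: complex_ext; rewrite /ctail //=.
by rewrite /tail Rintegral_cst ?mul0r //.
Qed.

Lemma polynomial_family_tail h : polynomial_family h ->
  polynomial_family (fun s x => ctail (h s) x).
Proof.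
elim=> [|{}h c i hh IH hc].
  by under eq_fun do under eq_fun do rewrite ctail0; exact: Polynomial_family0.
have -> : (fun s x => ctail (fun t => h s t + (c t)%:C%C * s ^+ i) x) =
    (fun s x => ctail (h s) x + (tail c x)%:C%C * s ^+ i).
  apply/funext => s; apply/funext => x; rewrite ctailD; last 2 first.
  - exact: polynomial_family_cfast.
  - exact: cfast_monomial.
  congr (_ + _); have -> : (fun t => (c t)%:C%C * s ^+ i) = (fun t => s ^+ i * (c t)%:C%C).
    by apply/funext => t; rewrite mulrC.
  rewrite ctailZ; last by split => //=; exact: fast0.
  by rewrite ctail_real mulrC.
by apply: Polynomial_familyS => //; exact: fast_tail.
Qed.

Lemma jost_iter_polynomial n :
  polynomial_family (fun s x => (jost_iter q s n).1 x - 1) /\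
  polynomial_family (fun s x => (jost_iter q s n).2 x).
Proof.
have [mq [K hK] _] := hq; have [fq _] := rapid_cfast hq.
elim: n => [|n [IH1 IH2]] /=.
  by split; [under eq_fun do under eq_fun do rewrite subrr|]; exact: Polynomial_family0.
split.
  have -> : (fun s x => 1 - ctail (jost_iter q s n).2 x - 1) =
     (fun s x => - ctail (jost_iter q s n).2 x).
    by apply/funext => s; apply/funext => x; rewrite addrAC subrr sub0r.
  by apply: polynomial_familyN; exact: (polynomial_family_tail IH2).
apply: polynomial_family_tail.
(* Since the first iterate tends to 1, it enters the family only after subtracting 1; the constant
   contributes the degree 0 term -q. *)
have -> : (fun s t => 2 * s * (jost_iter q s n).2 t - (q t)%:C%C * (jost_iter q s n).1 t) =
  (fun s t => (2%:C%C * (s * (jost_iter q s n).2 t) -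
    (q t)%:C%C * ((jost_iter q s n).1 t - 1)) + (- q t)%:C%C * s ^+ 0).
  apply/funext => s; apply/funext => t; rewrite expr0 rmorphN (rmorph_nat (real_complex R)) /=.
  by ring.
apply: Polynomial_familyS; last exact: fastN.
apply: polynomial_familyD; first by apply: polynomial_familyZ; exact: polynomial_familyX.
by apply: polynomial_familyN; exact: polynomial_familyM hK _.
Qed.

Lemma jost_entire x : entire (fun s => jost_m q s x) /\ entire (fun s => jost_p q s x).
Proof.
have E (e : R) r : 0 < e -> exists n, forall s, cabs s <= r ->
    cabs ((jost_iter q s n).1 x - jost_m q s x) <= e /\
    cabs ((jost_iter q s n).2 x - jost_p q s x) <= e.
  move=> e0; have [l _ h] := jost_iter_cvg hq r; have [A A0 hA] := h l (lexx l).
  have [n hn] := inv_pow2_small (A * expR (- l * x)) e0.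
  exists n => s sr; have [h1 h2] := hA s n x sr.
  by rewrite mulrAC in h1; rewrite mulrAC in h2; split; exact: le_trans hn.
split=> r e e0; have [n hn] := E e r e0; have [f1 f2] := jost_iter_polynomial n.
- have [P hP] := polynomial_family_evalC x f1; exists (P + 1%:P) => s sr.
  by rewrite evalCD evalCC -hP subrK cabsBC; have [] := hn s sr.
- have [P hP] := polynomial_family_evalC x f2; exists P => s sr.
  by rewrite -hP cabsBC; have [] := hn s sr.
Qed.

Lemma jost_m_conj s x : jost_m q (conjc s) x = conjc (jost_m q s x).
Proof. by have [h _] := jost_entire x; exact: (entire_conj s h). Qed.

End JostEntire.

Section Vanish.
Context {R : realType}.
Local Notation C := R[i].
Implicit Types (g h : R -> C).

Definition vanish g := forall e : R, 0 < e -> exists X, forall x, X <= x -> cabs (g x) <= e.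

Lemma eq_vanish g h : g =1 h -> vanish g -> vanish h.
Proof. by move=> gh hg e e0; have [X hX] := hg e e0; exists X => x /hX; rewrite gh. Qed.

Lemma vanishD g h : vanish g -> vanish h -> vanish (fun x => g x + h x).
Proof.
move=> hg hh e e0; have e2 : 0 < e / 2 by rewrite divr_gt0.
have [X hX] := hg _ e2; have [Y hY] := hh _ e2; exists (Num.max X Y) => x.
rewrite ge_max => /andP[xX xY]; rewrite (le_trans (cabsD _ _)) // [e]splitr.
by rewrite lerD ?hX ?hY.
Qed.

Lemma vanishM B g h : (exists X, forall x, X <= x -> cabs (g x) <= B) -> vanish h ->
  vanish (fun x => g x * h x).
Proof.
move=> [X hX] hh e e0.
have B1 : 0 < `|B| + 1 by rewrite ltr_wpDl.
have [Y hY] := hh _ (divr_gt0 e0 B1); exists (Num.max X Y) => x.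
rewrite ge_max => /andP[xX xY]; rewrite cabsM.
have -> : e = (`|B| + 1) * (e / (`|B| + 1)) by field; rewrite gt_eqF.
rewrite ler_pM ?cabs_ge0 ?hY // (le_trans (hX _ xX)) // (le_trans (ler_norm _)) //.
by rewrite lerDl.
Qed.

Lemma vanishZ (c : C) g : vanish g -> vanish (fun x => c * g x).
Proof. by apply: (@vanishM (cabs c)); exists 0. Qed.

Lemma vanishN g : vanish g -> vanish (fun x => - g x).
Proof. by move=> hg e e0; have [X hX] := hg e e0; exists X => x /hX; rewrite cabsN. Qed.

Lemma vanishB g h : vanish g -> vanish h -> vanish (fun x => g x - h x).
Proof. by move=> hg hh; apply: vanishD => //; exact: vanishN. Qed.

Lemma vanishMM g h : vanish g -> vanish h -> vanish (fun x => g x * h x).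
Proof. by move=> hg; apply: (@vanishM 1); exact: hg. Qed.

Lemma vanish_cst (c : C) : vanish (fun=> c) -> c = 0.
Proof.
move=> h; apply: cabs_small_eq0 => e e0; have [X hX] := h e e0.
exact: (hX X (lexx X)).
Qed.

Lemma cfast_vanish g : cfast g -> vanish g.
Proof.
move=> hg e e0; have [l0 l0p h] := cfast_cabs hg; have [A A0 hA] := h l0 (lexx l0).
have A1 : 0 < A + 1 by rewrite ltr_wpDl.
have /cvgrPdist_le /(_ _ (divr_gt0 e0 A1)) [X [_ hX]] := expR_negM_cvg0 l0p.
exists (X + 1) => x Xx; rewrite (le_trans (hA x)) //.
have Xx' : X < x by rewrite (lt_le_trans _ Xx) // ltrDl.
have := hX x Xx'; rewrite sub0r normrN ger0_norm ?expR_ge0 // ler_pdivlMr // => hx.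
by rewrite mulrC (le_trans _ hx) // ler_wpM2l ?expR_ge0 // lerDl.
Qed.

End Vanish.

(** * The Wronskian identity and bounds in the closed left half-plane *)

Section JostProperties.
Context {R : realType}.
Local Notation C := R[i].
Local Notation Re := (@complex.Re R).
Variables (q : R -> R) (hq : rapid_potential q).
Local Notation m := (jost_m q).
Local Notation p := (jost_p q).

Lemma jost_rhs_cfast s : cfast (fun t => 2 * s * p s t - (q t)%:C%C * m s t).
Proof.
have [c1 c2] := jost_cfast hq s.
by apply: cfastB; [exact: cfastZ|exact: rapid_cfastM1].
Qed.

Lemma jost_m_cprimitive s a b : cprimitive a b (m s) (p s).
Proof.
have [c1 c2] := jost_cfast hq s.
apply: eq_cprimitive (cprimitiveB (cprimitive_cst a b 1) (ctail_cprimitive a b c2)) => x _ _.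
  by have [-> _] := jost_equations hq s x.
by rewrite sub0r opprK.
Qed.

Lemma jost_p_cprimitive s a b :
  cprimitive a b (p s) (fun x => (q x)%:C%C * m s x - 2 * s * p s x).
Proof.
apply: eq_cprimitive (ctail_cprimitive a b (jost_rhs_cfast s)) => x _ _.
  by have [_ <-] := jost_equations hq s x.
by rewrite opprB.
Qed.

(** This is the Wronskian of e^(sx) m(x,s) and e^(-sx) m(x,-s), whose exponentials cancel. It is
    constant in x and equals its limit -2s at infinity. *)
Lemma jost_wronskian s x :
  -2 * s * m s x * m (- s) x + m s x * p (- s) x - m (- s) x * p s x = -2 * s.
Proof.
pose V x := -2 * s * (m s x * m (- s) x) + m s x * p (- s) x - m (- s) x * p s x.
suff : V x + 2 * s = 0.
  rewrite /V => h; apply/eqP; rewrite -subr_eq0; apply/eqP; rewrite -[RHS]h; ring.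
have Vc y : x <= y -> V x = V y.
  move=> xy.
  have M1 := jost_m_cprimitive s x y; have M2 := jost_m_cprimitive (- s) x y.
  have P1 := jost_p_cprimitive s x y; have P2 := jost_p_cprimitive (- s) x y.
  have := cprimitiveB (cprimitiveD (cprimitiveZ (-2 * s) (cprimitiveM M1 M2))
    (cprimitiveM M1 P2)) (cprimitiveM M2 P1).
  move=> /(cprimitive_eq0 xy); apply => t _ _; ring.
apply: vanish_cst.
have [c1 c2] := jost_cfast hq s; have [d1 d2] := jost_cfast hq (- s).
(* V + 2s expanded in m - 1 and p, which vanish at infinity. *)
have v : vanish (fun y => -2 * s * ((m s y - 1) * (m (- s) y - 1))
   + -2 * s * (m s y - 1) + -2 * s * (m (- s) y - 1)
   + (m s y - 1) * p (- s) y + p (- s) y - (m (- s) y - 1) * p s y - p s y).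
  apply: vanishB; last exact: cfast_vanish.
  apply: vanishB; last by apply: vanishMM; exact: cfast_vanish.
  apply: vanishD; last exact: cfast_vanish.
  apply: vanishD; last by apply: vanishMM; exact: cfast_vanish.
  apply: vanishD; last by apply: vanishZ; exact: cfast_vanish.
  apply: vanishD; last by apply: vanishZ; exact: cfast_vanish.
  by apply: vanishZ; apply: vanishMM; exact: cfast_vanish.
move=> e e0; have [X hX] := v e e0; exists X => z _.
have := hX (Num.max x X); rewrite le_max lexx orbT => /(_ isT).
rewrite (Vc (Num.max x X)) ?le_max ?lexx //; congr (cabs _ <= _).
by rewrite /V; ring.
Qed.

(* The improvement B -> (B + c) / 2 iterates to c; taking B the supremum gives it at once. *)
Lemma bound_of_contraction (phi : R -> R) (c B0 : R) :
  (forall x, 0 <= x -> phi x <= B0) ->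
  (forall B, (forall x, 0 <= x -> phi x <= B) -> forall x, 0 <= x -> phi x <= (B + c) / 2) ->
  forall x, 0 <= x -> phi x <= c.
Proof.
move=> h0 h.
pose S := [set phi x | x in [set x : R | 0 <= x]].
have ne : S !=set0 by exists (phi 0); exists 0 => //=.
have hs : has_sup S by split => //; exists B0 => _ [x /= x0 <-]; exact: h0.
have ub x : 0 <= x -> phi x <= sup S by move=> x0; apply: sup_upper_bound => //; exists x.
have : sup S <= (sup S + c) / 2.
  by apply: ge_sup => // _ [x /= x0 <-]; exact: h.
by move=> hS x x0; apply: (le_trans (ub x x0)); lra.
Qed.

Lemma cfast_bounded (g : R -> C) : cfast g -> exists B, forall x, 0 <= x -> cabs (g x) <= B.
Proof.
move=> hg; have [l l0 h] := cfast_cabs hg; have [A A0 hA] := h l (lexx l).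
exists A => x x0; rewrite (le_trans (hA x)) // -[leRHS]mulr1 ler_wpM2l //.
by rewrite -expR0 ler_expR mulNr oppr_le0 mulr_ge0 // ltW.
Qed.

Section HalfPlane.
Variables (D : R) (hD : forall x, `|q x| <= D * expR (- 1 * x)).
Variables (s : C) (hs : Re s <= 0) (M : R) (hM : forall x, 0 <= x -> cabs (m s x) <= M).

Lemma decay_const_ge0 : 0 <= D.
Proof. by have := le_trans (normr_ge0 _) (hD 0); rewrite mulr0 expR0 mulr1. Qed.

Lemma modulus_bound_ge0 : 0 <= M. Proof. exact: le_trans (cabs_ge0 _) (hM (lexx 0)). Qed.

Lemma cabs_qm_bound x : 0 <= x -> cabs ((q x)%:C%C * m s x) <= D * M * expR (- 1 * x).
Proof.
by move=> x0; rewrite cabsM cabsR mulrAC ler_pM ?cabs_ge0 // hM.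
Qed.

(* Energy estimate: (|p|^2)' = 2 q Re(p^* m) - 4 Re(s) |p|^2 >= -2 |q| |p| |m|. *)
Lemma jost_p_energy x B : 0 <= x -> (forall y, 0 <= y -> cabs (p s y) <= B) ->
  cabs (p s x) ^+ 2 <= 2 * B * M * D.
Proof.
move=> x0 hB.
have B0 : 0 <= B := le_trans (cabs_ge0 _) (hB 0 (lexx 0)).
pose K := 2 * B * M * D.
have K0 : 0 <= K by rewrite !mulr_ge0 // ?modulus_bound_ge0 ?decay_const_ge0.
have mono y : x <= y -> cabs (p s x) ^+ 2 <= cabs (p s y) ^+ 2 + K.
  move=> xy.
  have pe := primitiveB (primitive_cabs_sqr (jost_p_cprimitive s x y))
    (primitiveM (primitive_cst x y K) (primitive_expR x y (- 1))).
  have h := primitive_ge0 xy pe _.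
  have {}h : cabs (p s x) ^+ 2 - K * expR (- 1 * x) <= cabs (p s y) ^+ 2 - K * expR (- 1 * y).
    apply: h => t xt ty; rewrite mul0r add0r.
    have t0 := le_trans x0 xt.
    have -> : 2 * Re (conjc (p s t) * ((q t)%:C%C * m s t - 2 * s * p s t)) =
      2 * Re (conjc (p s t) * ((q t)%:C%C * m s t)) - 4 * Re s * cabs (p s t) ^+ 2.
      rewrite cabs_sqr; case: (p s t) => a b; case: (m s t) => c d; case: s => e f /=; ring.
    have h1 : - (B * (D * M * expR (- 1 * t))) <= Re (conjc (p s t) * ((q t)%:C%C * m s t)).
      rewrite lerNl (le_trans (ler_norm _)) // normrN (le_trans (cabs_Re _)) // cabsM cabs_conj.
      by rewrite ler_pM ?cabs_ge0 ?hB ?cabs_qm_bound.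
    have h2 : 0 <= - (4 * Re s * cabs (p s t) ^+ 2).
      by rewrite oppr_ge0 mulr_le0_ge0 ?sqr_ge0 // mulr_ge0_le0.
    have -> : K * (- 1 * expR (- 1 * t)) = - 2 * (B * (D * M * expR (- 1 * t))) by rewrite /K; ring.
    lra.
  have e1 : K * expR (- 1 * x) <= K.
    by rewrite ler_piMr // mulN1r -expR0 ler_expR oppr_le0.
  have e2 : 0 <= K * expR (- 1 * y) by rewrite mulr_ge0 ?expR_ge0.
  lra.
have [_ c2] := jost_cfast hq s.
apply/ler_addgt0Pr => e e0.
have [X hX] := vanishMM (cfast_vanish c2) (cfast_vanish c2) e0.
have := hX (Num.max x X); rewrite le_max lexx orbT => /(_ isT); rewrite cabsM -expr2 => h.
by rewrite (le_trans (mono (Num.max x X) _)) ?le_max ?lexx // addrC lerD2l.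
Qed.

(** With c = 2MD the energy estimate reads |p|^2 <= B c, and the arithmetic-geometric inequality
    improves the bound B to (B + c)/2. *)
Lemma jost_p_bound x : 0 <= x -> cabs (p s x) <= 2 * M * D.
Proof.
have [_ c2] := jost_cfast hq s; have [B0 hB0] := cfast_bounded c2.
apply: (bound_of_contraction hB0) => B hB y y0.
have B0' : 0 <= B := le_trans (cabs_ge0 _) (hB 0 (lexx 0)).
have c0 : 0 <= 2 * M * D by rewrite !mulr_ge0 // ?modulus_bound_ge0 ?decay_const_ge0.
rewrite -(ler_pXn2r (n := 2)) ?nnegrE ?cabs_ge0 ?divr_ge0 ?addr_ge0 //.
rewrite (le_trans (jost_p_energy y0 hB)) //.
have -> : 2 * B * M * D = B * (2 * M * D) by ring.
by move: (2 * M * D) c0 => c c0; have := sqr_ge0 (B - c); rewrite expr_div_n; lra.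
Qed.

(** The integrated equation for p gives 2s (m - 1) = -p minus the tail integral of q m. Both terms
    are bounded by 2MD independently of s, hence m - 1 = O(1/|s|). *)
Lemma jost_m_bound x : 0 <= x -> cabs s * cabs (m s x - 1) <= 2 * M * D.
Proof.
move=> x0; have [c1 c2] := jost_cfast hq s; have [e1 e2] := jost_equations hq s x.
have E : 2 * s * (m s x - 1) = - p s x - ctail (fun t => (q t)%:C%C * m s t) x.
  rewrite e2 ctailB; last 2 first.
  - exact: cfastZ.
  - exact: rapid_cfastM1.
  by rewrite ctailZ // e1; ring.
have b := ctail_bound ltr01 (rapid_cfastM1 hq c1)
  (fun t xt => cabs_qm_bound (le_trans x0 xt)).
have {}b : cabs (ctail (fun t => (q t)%:C%C * m s t) x) <= 2 * M * D.
  rewrite (le_trans b) // divr1.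
  have -> : 2 * (D * M) = 2 * M * D by ring.
  rewrite ler_piMr ?mulr_ge0 ?modulus_bound_ge0 ?decay_const_ge0 //.
  by rewrite mulN1r -expR0 ler_expR oppr_le0.
have : cabs (2 * s * (m s x - 1)) <= 2 * (2 * M * D).
  rewrite E (le_trans (cabsB _ _)) // cabsN.
  by have := jost_p_bound x0; lra.
rewrite !cabsM.
have -> : cabs (2 : C) = 2 by exact: cabs_nat.
lra.
Qed.

End HalfPlane.

(** The estimates in terms of a bound of |m| are closed by a bootstrap. The lower bound on |m|
    permits division by m at s, never at -s. *)
Lemma jost_half_plane : exists2 c, 0 < c & forall s, Re s <= 0 -> c <= cabs s -> forall x, 0 <= x ->
  [/\ cabs (m s x) <= 2, 2^-1 <= cabs (m s x), cabs s * cabs (m s x - 1) <= c &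
      cabs (p s x) <= c].
Proof.
have [_ _ dq] := hq; have [D hD] := dq 1 ltr01; have D0 := decay_const_ge0 hD.
(* For |s| >= 8D + 1, |m| <= B implies |m - 1| <= B/4, so |m| <= 1 + B/4 <= (B + 2)/2 and B
   contracts to 2. With B = 2 this gives |m - 1| <= 1/2. *)
exists (8 * D + 1); first lra.
move=> s s0 sc.
have [c1 c2] := jost_cfast hq s; have [B0 hB0] := cfast_bounded c1.
have h2 x : 0 <= x -> cabs (m s x) <= 2.
  apply: (@bound_of_contraction (fun x => cabs (m s x)) 2 (B0 + 1)) => [y y0|B hB y y0].
    by rewrite -[m s y](subrK 1) (le_trans (cabsD _ _)) // cabs1 lerD2r hB0.
  have B0' : 0 <= B := le_trans (cabs_ge0 _) (hB 0 (lexx 0)).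
  have := jost_m_bound hD s0 hB y0.
  have := cabsD (m s y - 1) 1; rewrite subrK cabs1.
  have := cabs_ge0 (m s y - 1).
  move: (cabs (m s y - 1)) (cabs s) sc (cabs (m s y)) => d z zc w; nra.
move=> x x0.
have h3 := jost_m_bound hD s0 h2 x0.
have h4 := jost_p_bound hD s0 h2 x0.
split; [exact: h2| |lra|lra].
have := cabsB (m s x) (m s x - 1); rewrite subKr cabs1.
have := cabs_ge0 (m s x - 1).
move: (cabs (m s x - 1)) (cabs s) sc h3 (cabs (m s x)) => d z zc h3 w; nra.
Qed.

End JostProperties.

(** * Uniqueness of the Jost solution *)

Section Caratheodory.
Context {R : realType}.
Local Notation mu := (@lebesgue_measure R).
Local Notation C := R[i].
Local Notation Re := (@complex.Re R).
Local Notation Im := (@complex.Im R).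

Lemma ac_deriv_bounded (v g : R -> R) a b : ac_deriv v g -> 0 < a ->
  exists B, forall x, a <= x -> x <= b -> `|v x| <= B.
Proof.
move=> h a0.
exists (`|v a| + \int[mu]_(t in `[a, b]) `|g t|) => x ax xb.
have [ix ex] := h a x a0 ax; have [ib _] := h a b a0 (le_trans ax xb).
rewrite -[v x](subrKC (v a)) (le_trans (ler_normD _ _)) // lerD2l ex.
rewrite (le_trans (@le_normr_Rintegral _ _ _ mu _ _ _ ix)) //.
rewrite [leRHS](@Rintegral_itv_split _ a b x) //; last exact: integrable_norm ib.
by rewrite lerDl; exact: Rintegral_ge0.
Qed.

(** The derivative is itself an indefinite integral, hence bounded on compact intervals of (0, oo),
    which upgrades local integrability to the class [primitive]. *)
Lemma ac_deriv_primitive (v g h : R -> R) a b : ac_deriv v g -> ac_deriv g h ->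
  0 < a -> primitive a b v g.
Proof.
move=> hv hg a0; have [B hB] := ac_deriv_bounded b hg a0.
split; last by move=> x y ax xy yb; have [] := hv x y (lt_le_trans a0 ax) xy.
split; last by exists B.
have [ab|ba] := leP a b; last by rewrite set_itv_ge ?bnd_simp -?ltNge //; exact: measurable_fun_set0.
by have [/integrableP[/measurable_EFinP]] := hv a b a0 ab.
Qed.

Lemma ac_deriv_ae_primitive (v g h : R -> R) a b : ac_deriv v g -> 0 < a ->
  bounded_measurable a b h -> {ae mu, forall x, 0 < x -> g x = h x} -> primitive a b v h.
Proof.
move=> hv a0 bh gh; split => // x y ax xy yb.
have x0 := lt_le_trans a0 ax.
have [ig ->] := hv x y x0 xy.
rewrite /Rintegral; congr fine; apply: ae_eq_integral => //.
- by case/integrableP : ig.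
- by have /integrableP[] := bounded_measurable_integrable bh ax yb.
- apply: (@filterS _ _ (ae_filter_ringOfSetsType mu) _ _ _ gh) => t gt /=; rewrite in_itv /= => /andP[xt _].
  by rewrite gt // (lt_le_trans x0).
Qed.

Lemma cprimitive_bound (u g : R -> C) a b B : a <= b -> cprimitive a b u g ->
  (forall x, a <= x -> x <= b -> cabs (g x) <= B) -> cabs (u b - u a) <= 2 * B * (b - a).
Proof.
move=> ab [[b1 u1] [b2 u2]] hB; rewrite (le_trans (cabs_le _)) //.
rewrite cReD cImD cReN cImN u1 // u2 //.
have -> : 2 * B * (b - a) = B * (b - a) + B * (b - a) by ring.
rewrite lerD // Rintegral_itv_bound // => t at_ tb.
- by rewrite (le_trans (cabs_Re _)) // hB.
- by rewrite (le_trans (cabs_Im _)) // hB.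
Qed.

Lemma cprimitive_bounded (u g : R -> C) a b : cprimitive a b u g ->
  exists B, forall x, a <= x -> x <= b -> cabs (g x) <= B.
Proof.
move=> [[[_ [B hB]] _] [[_ [D hD]] _]]; exists (B + D) => x ax xb.
by rewrite (le_trans (cabs_le _)) // lerD ?hB ?hD.
Qed.

Lemma cprimitive_id a b (c : C) : cprimitive a b (fun x => x%:C%C * c) (fun=> c).
Proof.
have h (d : R) : primitive a b (fun x => x * d) (fun=> d).
  split; first exact: bounded_measurable_cst.
  by move=> x y ax xy yb; rewrite Rintegral_itv_cst //; ring.
split.
- by apply: eq_primitive (h (Re c)) => x _ _ //; rewrite cReRM.
- by apply: eq_primitive (h (Im c)) => x _ _ //; rewrite cImRM.
Qed.

End Caratheodory.

Section Uniqueness.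
Context {R : realType}.
Local Notation mu := (@lebesgue_measure R).
Local Notation C := R[i].
Local Notation Re := (@complex.Re R).
Local Notation Im := (@complex.Im R).
Variables (q : R -> R) (hq : rapid_potential q).
Local Notation m := (jost_m q).
Local Notation p := (jost_p q).

Section Normalised.
Variables (s : C) (s_im : Re s = 0) (s_neq0 : s != 0) (w v : R -> C).
Hypothesis w_prim : forall a b, 0 < a -> a <= b -> cprimitive a b w v.
Hypothesis v_prim : forall a b, 0 < a -> a <= b ->
  cprimitive a b v (fun x => (q x)%:C%C * w x - 2 * s * v x).
Hypothesis w_lim : vanish (fun x => w x - 1).

(* 2 s w + v has the integrable derivative q w, so v varies little on [x, x+1] for
   large x; as w converges, v must be small there. *)
Lemma normalised_derivative_vanish : vanish v.
Proof.
have [_ _ dq] := hq; have [D hD] := dq 1 ltr01; have D0 := decay_const_ge0 hD.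
move=> e e0.
have cs := cabs_ge0 s.
(* The final estimate is |v(x)| <= 2d + 2 (4 + 4|s|) d = (10 + 8|s|) d. *)
pose d := Num.min 1 (e / (10 + 8 * cabs s)).
have d0 : 0 < d by rewrite lt_min ltr01 divr_gt0 // ltr_wpDr ?mulr_ge0.
have d1 : d <= 1 by rewrite ge_min lexx.
have de : (10 + 8 * cabs s) * d <= e.
  have : d <= e / (10 + 8 * cabs s) by rewrite ge_min lexx orbT.
  by rewrite ler_pdivlMr ?ltr_wpDr ?mulr_ge0 // mulrC.
have [X hX] := w_lim d0.
have D1 : 0 < D + 1 by rewrite ltr_wpDl.
have /cvgrPdist_le /(_ _ (divr_gt0 d0 D1)) [Y [_ hY]] := @expR_negM_cvg0 R 1 ltr01.
exists (Num.max 1 (Num.max X (Y + 1))) => x; rewrite !ge_max => /and3P[x1 xX xY].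
have x0 : 0 < x by rewrite (lt_le_trans ltr01).
have qd t : x <= t -> `|q t| <= d.
  move=> xt; rewrite (le_trans (hD t)) //.
  have := hY t; rewrite sub0r normrN ger0_norm ?expR_ge0 // => /(_ _)/wrap[|].
    by rewrite (lt_le_trans _ (le_trans xY xt)) // ltrDl.
  rewrite ler_pdivlMr // mulrC => /(le_trans _); apply.
  by rewrite ler_wpM2r ?expR_ge0 // lerDl.
have wd t : x <= t -> cabs (w t - 1) <= d by move=> xt; apply: hX; exact: le_trans xt.
have w2 t : x <= t -> cabs (w t) <= 2.
  move=> xt; have := wd t xt; have := cabsD (w t - 1) 1; rewrite subrK cabs1; lra.
have ww t y : x <= t -> x <= y -> cabs (w t - w y) <= 2 * d.
  move=> xt xy; have := wd t xt; have := wd y xy.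
  by have := cabs_sub_trans 1 (w t) (w y); rewrite [cabs (1 - _)]cabsBC; lra.
pose L t := 2 * s * w t + v t.
have Ld t : x <= t -> t <= x + 1 -> cabs (L t - L x) <= 4 * d.
  move=> xt tx.
  have pL := cprimitiveD (cprimitiveZ (2 * s) (w_prim x0 xt)) (v_prim x0 xt).
  have h := cprimitive_bound (B := 2 * d) xt pL _.
  rewrite (le_trans (h _)) //; last by nra.
  move=> y xy yt; rewrite subrKC cabsM cabsR mulrC.
  by rewrite ler_pM ?cabs_ge0 ?w2 ?qd.
have two : cabs (2 : C) = 2 by exact: cabs_nat.
have vd t : x <= t -> t <= x + 1 -> cabs (v t - v x) <= (4 + 4 * cabs s) * d.
  move=> xt tx; have -> : v t - v x = L t - L x - 2 * s * (w t - w x) by rewrite /L; ring.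
  rewrite (le_trans (cabsB _ _)) // [leRHS]mulrDl lerD ?Ld // !cabsM two.
  have -> : 4 * cabs s * d = 2 * cabs s * (2 * d) by ring.
  by rewrite ler_wpM2l ?mulr_ge0 // ww.
have xx1 : x <= x + 1 by rewrite lerDl.
(* Comparing w on [x, x+1] with the affine function of slope v(x) expresses v(x) as w(x+1) - w(x) up
   to the variation of v. *)
have pU := cprimitiveB (w_prim x0 xx1) (cprimitive_id x (x + 1) (v x)).
have h := cprimitive_bound xx1 pU vd.
have {}h : cabs (w (x + 1) - w x - v x) <= 2 * ((4 + 4 * cabs s) * d).
  move: h; have -> : 2 * ((4 + 4 * cabs s) * d) * (x + 1 - x) = 2 * ((4 + 4 * cabs s) * d) by ring.
  congr (cabs _ <= _).
  by rewrite rmorphD /=; ring.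
have := cabsB (w (x + 1) - w x) (w (x + 1) - w x - v x); rewrite subKr.
by have := ww (x + 1) x xx1 (lexx x); lra.
Qed.

(** T = m v - w p satisfies T' = -2s T, so for Re s = 0 its modulus is constant, and it vanishes at
    infinity. Since w and m have the same Wronskian -2s with m(-s), m(-s) T = -2s (w - m), and no
    division by m occurs. *)
Lemma normalised_unique x : 0 < x -> w x = m s x.
Proof.
move=> x0.
have [c1 c2] := jost_cfast hq s; have [d1 d2] := jost_cfast hq (- s).
have v0 := normalised_derivative_vanish.
have T0 : m s x * v x - w x * p s x = 0.
  pose T t := m s t * v t - w t * p s t.
  have vT : vanish T.
    apply: (@eq_vanish _ (fun t => (m s t - 1) * v t + v t - (w t - 1) * p s t - p s t)).
      by move=> t; rewrite /T; ring.
    apply: vanishB; last exact: cfast_vanish.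
    apply: vanishB; last by apply: vanishMM => //; exact: cfast_vanish.
    apply: vanishD => //; apply: vanishMM => //; exact: cfast_vanish.
  have cT y : x <= y -> cabs (T x) = cabs (T y).
    move=> xy.
    have M1 := jost_m_cprimitive hq s x y; have P1 := jost_p_cprimitive hq s x y.
    have := primitive_cabs_sqr (cprimitiveB (cprimitiveM M1 (v_prim x0 xy))
       (cprimitiveM (w_prim x0 xy) P1)).
    move=> /(primitive_eq0 xy) h; apply/eqP; rewrite -(@eqrXn2 _ 2) ?cabs_ge0 //; apply/eqP.
    apply: h => t _ _.
    set a := m s t; set b := v t; set c := w t; set e := p s t.
    have -> : e * b + a * ((q t)%:C%C * c - 2 * s * b) -
      (b * e + c * ((q t)%:C%C * a - 2 * s * e)) = - 2 * s * (a * b - c * e) by ring.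
    case: (a * b - c * e) => f g; case: s s_im => s1 s2 /= ->; ring.
  apply: cabs_small_eq0 => e e0; have [X hX] := vT e e0.
  by rewrite -/(T x) (cT (Num.max x X)) ?le_max ?lexx // hX // le_max lexx orbT.
have V1 : -2 * s * w x * m (- s) x + w x * p (- s) x - m (- s) x * v x = -2 * s.
  pose V t := -2 * s * (w t * m (- s) t) + w t * p (- s) t - m (- s) t * v t.
  suff : V x + 2 * s = 0.
    by rewrite /V => h; apply/eqP; rewrite -subr_eq0; apply/eqP; rewrite -[RHS]h; ring.
  have Vc y : x <= y -> V x = V y.
    move=> xy.
    have M2 := jost_m_cprimitive hq (- s) x y; have P2 := jost_p_cprimitive hq (- s) x y.
    have := cprimitiveB (cprimitiveD (cprimitiveZ (-2 * s) (cprimitiveM (w_prim x0 xy) M2))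
      (cprimitiveM (w_prim x0 xy) P2)) (cprimitiveM M2 (v_prim x0 xy)).
    by move=> /(cprimitive_eq0 xy); apply => t _ _; ring.
  apply: vanish_cst.
  have vv : vanish (fun y => -2 * s * ((w y - 1) * (m (- s) y - 1))
     + -2 * s * (w y - 1) + -2 * s * (m (- s) y - 1)
     + (w y - 1) * p (- s) y + p (- s) y - (m (- s) y - 1) * v y - v y).
    apply: vanishB; last by [].
    apply: vanishB; last by apply: vanishMM => //; exact: cfast_vanish.
    apply: vanishD; last exact: cfast_vanish.
    apply: vanishD; last by apply: vanishMM => //; exact: cfast_vanish.
    apply: vanishD; last by apply: vanishZ; exact: cfast_vanish.
    apply: vanishD; last by apply: vanishZ.
    by apply: vanishZ; apply: vanishMM => //; exact: cfast_vanish.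
  move=> e e0; have [X hX] := vv e e0; exists X => z _.
  have := hX (Num.max x X); rewrite le_max lexx orbT => /(_ isT).
  rewrite (Vc (Num.max x X)) ?le_max ?lexx //; congr (cabs _ <= _).
  by rewrite /V; ring.
have V2 := jost_wronskian hq s x.
have s0 : -2 * s != 0 by rewrite mulf_neq0 // oppr_eq0 pnatr_eq0.
apply: (mulfI s0).
have : m (- s) x * (m s x * v x - w x * p s x) = 0 by rewrite T0 mulr0.
have -> : m (- s) x * (m s x * v x - w x * p s x) =
  w x * (-2 * s * m s x * m (- s) x + m s x * p (- s) x - m (- s) x * p s x) -
  m s x * (-2 * s * w x * m (- s) x + w x * p (- s) x - m (- s) x * v x) by ring.
rewrite V1 V2 => /eqP; rewrite subr_eq0 => /eqP h.
by rewrite mulrC h mulrC.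
Qed.

End Normalised.

Lemma cabs_expi (t : R) : cabs (expi t) = 1.
Proof. by rewrite cabsE /= cos2Dsin2 sqrtr1. Qed.

Lemma expiD (t u : R) : expi (t + u) = expi t * expi u.
Proof. by apply: complex_ext; rewrite ?cReM ?cImM /= ?cosD ?sinD //; ring. Qed.

Lemma expi0 : expi (0 : R) = 1.
Proof. by rewrite /expi cos0 sin0. Qed.

(** Here [q0] is the given potential and [q] its representative with pointwise bounds.
    Multiplication by e^(-ikx) brings a Caratheodory solution to the normalised form. *)
Lemma jost_solution_eq (q0 : R -> R) (k : R) (u : R -> C) : 0 < k ->
  {ae mu, forall x, 0 < x -> q0 x = q x} -> jost_solution q0 k u ->
  forall x, 0 < x -> u x = expi (k * x) * m (k%:C%C * 'i%C) x.
Proof.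
move=> k0 q0q [[u1 [u2 [[a1 a2] [b1 b2] ode]]] lim] x x0.
have [mq [K hK] _] := hq.
set s := k%:C%C * 'i%C.
have p0 a b : 0 < a -> cprimitive a b u u1.
  by move=> a0; split; apply: ac_deriv_primitive; eassumption.
have bq a b : bounded_measurable a b q by split; [exact: measurable_funS mq|exists K].
have ae2 : {ae mu, forall x, 0 < x -> u2 x = (q x)%:C%C * u x - (k ^+ 2)%:C%C * u x}.
  apply: (@filterS2 _ _ (ae_filter_ringOfSetsType mu) _ _ _ _ ode q0q) => t h1 h2 t0.
  have /eqP := h1 t0; rewrite h2 // subr_eq0 => /eqP <-; ring.
have p1 a b : 0 < a -> cprimitive a b u1 (fun x => (q x)%:C%C * u x - (k ^+ 2)%:C%C * u x).
  move=> a0; have [pr pi] := p0 a b a0.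
  have br := primitive_bounded_measurable pr; have bi := primitive_bounded_measurable pi.
  have bg c : bounded_measurable a b c -> bounded_measurable a b (fun x => q x * c x - k ^+ 2 * c x).
    move=> bc; apply: bounded_measurableB; apply: bounded_measurableM => //.
    exact: bounded_measurable_cst.
  split.
  - apply: (ac_deriv_ae_primitive b1 a0).
      by apply: eq_bounded_measurable (bg _ br) => t _ _; rewrite cReD cReN !cReRM.
    by apply: (@filterS _ _ (ae_filter_ringOfSetsType mu) _ _ _ ae2) => t h t0; rewrite h.
  - apply: (ac_deriv_ae_primitive b2 a0).
      by apply: eq_bounded_measurable (bg _ bi) => t _ _; rewrite cImD cImN !cImRM.
    by apply: (@filterS _ _ (ae_filter_ringOfSetsType mu) _ _ _ ae2) => t h t0; rewrite h.
pose om t := expi (- k * t).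
pose w t := om t * u t.
pose v t := om t * (u1 t - s * u t).
have s_im : Re s = 0 by rewrite /s /=; ring.
have s_neq0 : s != 0.
  apply/eqP => /(congr1 Im) /= /eqP; rewrite mul0r mulr1 addr0.
  by rewrite gt_eqF.
have si : s ^+ 2 = - (k ^+ 2)%:C%C.
  by rewrite /s; apply: complex_ext => /=; ring.
have pom a b : cprimitive a b om (fun t => - s * om t).
  apply: eq_cprimitive (cprimitive_expi a b (- k)) => t _ _ //.
  by rewrite /om /s rmorphN /= mulNr.
have pw a b : 0 < a -> a <= b -> cprimitive a b w v.
  move=> a0 ab; apply: eq_cprimitive (cprimitiveM (pom a b) (p0 a b a0)) => t _ _ //.
  by rewrite /v; ring.
have pv a b : 0 < a -> a <= b ->
    cprimitive a b v (fun x => (q x)%:C%C * w x - 2 * s * v x).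
  move=> a0 ab; apply: eq_cprimitive (cprimitiveM (pom a b)
    (cprimitiveB (p1 a b a0) (cprimitiveZ s (p0 a b a0)))) => t _ _ //.
  have -> : (k ^+ 2)%:C%C = - s ^+ 2 by rewrite si opprK.
  by rewrite /v /w; ring.
have omK t : expi (k * t) * om t = 1.
  by rewrite /om -expiD -mulrDl addrN mul0r expi0.
have vw : vanish (fun t => w t - 1).
  move=> e e0; move/cvgrPdist_le : lim => /(_ e e0) [X [_ hX]].
  exists (X + 1) => t Xt; have := hX t (lt_le_trans _ Xt).
  rewrite sub0r normrN ger0_norm ?cabs_ge0 // => /(_ _)/wrap[|].
    by rewrite ltrDl.
  have -> : w t - 1 = om t * (u t - expi (k * t)) by rewrite -(omK t) /w; ring.
  by rewrite cabsM cabs_expi mul1r.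
by rewrite -(normalised_unique s_im s_neq0 pw pv vw x0) /w mulrA omK mul1r.
Qed.

(** The function e^(ikx) m(x, ik) is Lipschitz on [0, 1], so its limit at 0+ is its value at 0. *)
Lemma jost_function_eq (q0 : R -> R) (F : R -> C) (k : R) : 0 < k ->
  {ae mu, forall x, 0 < x -> q0 x = q x} -> jost_function q0 F ->
  F k = m (k%:C%C * 'i%C) 0.
Proof.
move=> k0 q0q /(_ k k0) [u [ju lim]].
set s := k%:C%C * 'i%C.
apply/eqP; rewrite -subr_eq0; apply/eqP/cabs_small_eq0 => e e0.
have pr := cprimitiveM (cprimitive_expi 0 1 k) (jost_m_cprimitive hq s 0 1).
have [B hB] := cprimitive_bounded pr.
have B0 : 0 <= B := le_trans (cabs_ge0 _) (hB 0 (lexx 0) ler01).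
have e2 : 0 < e / 2 by rewrite divr_gt0.
have B1 : 0 < 2 * B + 1 by rewrite ltr_wpDl // mulr_ge0.
move/cvgrPdist_le : lim => /(_ _ e2) lim.
near (0 : R)^'+ => x.
have x0 : 0 < x by near: x; exact: nbhs_right_gt.
have x1 : x <= 1 by near: x; exact: nbhs_right_le.
have xe : x <= e / 2 / (2 * B + 1) by near: x; apply: nbhs_right_le; rewrite divr_gt0.
have h1 : `|0 - cabs (u x - F k)| <= e / 2 by near: x.
rewrite sub0r normrN ger0_norm ?cabs_ge0 // in h1.
have h3 : cabs (u x - m s 0) <= 2 * B * x.
  have pr' := cprimitiveM (cprimitive_expi 0 x k) (jost_m_cprimitive hq s 0 x).
  have := cprimitive_bound (B := B) (ltW x0) pr' _.
  rewrite mulr0 expi0 mul1r subr0 (jost_solution_eq k0 q0q ju x0); apply.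
  by move=> t t0 tx; apply: hB => //; exact: le_trans x1.
rewrite (le_trans (cabs_sub_trans (u x) _ _)) // cabsBC [e]splitr lerD //.
rewrite (le_trans h3) //; move: xe; rewrite ler_pdivlMr // => xe; nra.
Unshelve. all: by end_near. Qed.

End Uniqueness.

(** * The inverse problem *)

Section SuperexpDecay.
Context {R : realType}.
Local Notation mu := (@lebesgue_measure R).

(** With X = (l/c)^(1/(gamma-1)): beyond X one has c x^gamma >= l x, and up to X the right side is
    at least 1. *)
Lemma expR_powR_le (c gamma l x : R) : 0 < c -> 1 < gamma -> 0 < l -> 0 < x ->
  expR (- c * x `^ gamma) <= expR (l * (l / c) `^ (gamma - 1)^-1) * expR (- l * x).
Proof.
move=> c0 g1 l0 x0; rewrite -expRD ler_expR.
set X := (l / c) `^ _.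
have X0 : 0 <= X by exact: powR_ge0.
have p0 : 0 <= x `^ gamma by exact: powR_ge0.
have g0 : 0 < gamma - 1 by rewrite subr_gt0.
have [xX|/ltW Xx] := leP x X; first by nra.
have h : l / c <= x `^ (gamma - 1).
  have -> : l / c = X `^ (gamma - 1).
    by rewrite -powRrM mulVf ?gt_eqF // powRr1 // divr_ge0 // ltW.
  by apply: ge0_ler_powR; rewrite ?nnegrE ?(ltW x0) ?(ltW g0).
have : l * x <= c * x `^ gamma.
  rewrite -(mulr_powRB1 (ltW x0) (lt_trans ltr01 g1)) mulrCA [leLHS]mulrC.
  by rewrite ler_wpM2l ?(ltW x0) // mulrC -ler_pdivrMr.
nra.
Qed.

Lemma superexp_rapid (q : R -> R) : L11 q -> superexp_decay q ->
  exists2 r, rapid_potential r & {ae mu, forall x, 0 < x -> q x = r x}.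
Proof.
move=> [mq _] [c [gamma [c0 g1 hq]]].
pose b (x : R) := c * expR (- c * `|x| `^ gamma).
pose q1 := q \_ Rplus.
(* Extending by zero to the negative axis and replacing by zero where the bound fails makes the
   almost everywhere bound pointwise. On (0, oo) only a null set is affected. *)
pose r (x : R) := if `|q1 x| <= b x then q1 x else 0.
have b0 x : 0 <= b x by rewrite mulr_ge0 ?expR_ge0 // ltW.
have rb x : `|r x| <= b x by rewrite /r; case: ifPn => // _; rewrite normr0.
have q1N x : x <= 0 -> q1 x = 0.
  by move=> x0; rewrite /q1 patchE memNset // /Rplus /= in_itv /= andbT ltNge x0.
have q1P x : 0 < x -> q1 x = q x.
  by move=> x0; rewrite /q1 patchE mem_set // /Rplus /= in_itv /= andbT.
have rN x : x <= 0 -> r x = 0 by move=> x0; rewrite /r q1N //; case: ifP.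
exists r; last first.
  apply: (@filterS _ _ (ae_filter_ringOfSetsType mu) _ _ _ hq) => x h x0.
  by rewrite /r q1P // /b h.
split.
- have m1 : measurable_fun setT q1 by apply/(measurable_restrictT _ _).1 => //; exact: measurable_itv.
  have mb : measurable_fun setT b.
    apply: measurable_funM; first exact: measurable_cst.
    apply: (measurableT_comp (@measurable_expR R)).
    apply: measurable_funM; first exact: measurable_cst.
    by apply: (measurableT_comp (measurable_powR _)).
  apply: measurable_fun_ifT => //.
  by apply: measurable_fun_ler => //; exact: measurableT_comp.
- exists c => x; rewrite (le_trans (rb x)) // /b ger_pMr // -expR0 ler_expR.
  by rewrite mulNr oppr_le0 mulr_ge0 ?powR_ge0 // ltW.
- move=> l l0; exists (c * expR (l * (l / c) `^ (gamma - 1)^-1)) => x.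
  have [x0|x0] := leP x 0.
    by rewrite rN // normr0 !mulr_ge0 ?expR_ge0 // ltW.
  rewrite (le_trans (rb x)) // /b gtr0_norm // -mulrA ler_wpM2l ?(ltW c0) //.
  exact: expR_powR_le.
Qed.

End SuperexpDecay.

(** * From the cross term to the potentials *)

Section InverseProblem.
Context {R : realType}.
Local Notation mu := (@lebesgue_measure R).
Local Notation C := R[i].
Local Notation Re := (@complex.Re R).
Variables (q1 q2 : R -> R) (hq1 : rapid_potential q1) (hq2 : rapid_potential q2).
Local Notation m1 := (jost_m q1).
Local Notation p1 := (jost_p q1).
Local Notation m2 := (jost_m q2).
Local Notation p2 := (jost_p q2).

(* f1(x,-k) f2(x,k) - f1(x,k) f2(x,-k): the exponential factors cancel. *)
Definition jost_cross x s := m1 (- s) x * m2 s x - m1 s x * m2 (- s) x.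

(** In Jost solutions, f1(x,s) f2'(x,-s) - f1(x,-s) f2'(x,s) with the exponentials cancelled. For
    equal potentials this is the Wronskian -2s. *)
Definition mixed_wronskian x s :=
  m1 s x * (- s * m2 (- s) x + p2 (- s) x) - m1 (- s) x * (s * m2 s x + p2 s x).

Lemma jost_cross_entire x : entire (jost_cross x).
Proof.
have [e1 _] := jost_entire hq1 x; have [e2 _] := jost_entire hq2 x.
by apply: entireB; apply: entireM => //; exact: (@entire_opp _ (fun s => _ s x)).
Qed.

Lemma mixed_wronskian_entire x : entire (mixed_wronskian x).
Proof.
have [e1 f1] := jost_entire hq1 x; have [e2 f2] := jost_entire hq2 x.
have i : entire (fun s : C => s) := entireX.
apply: entireB; apply: entireM => //.
- apply: entireD; last exact: (entire_opp f2).
  by apply: entireM; [exact: entireN|exact: (entire_opp e2)].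
- exact: (entire_opp e1).
- by apply: entireD => //; exact: entireM.
Qed.

Lemma half_plane_bounds : exists2 c, 0 < c & forall s, Re s <= 0 -> c <= cabs s ->
  forall x, 0 <= x -> [/\ cabs (m1 s x) <= 2, 2^-1 <= cabs (m1 s x), cabs (p1 s x) <= c &
    [/\ cabs (m2 s x) <= 2, 2^-1 <= cabs (m2 s x), cabs (p2 s x) <= c,
      cabs s * cabs (m1 s x - 1) <= c &
      cabs s * cabs (m2 s x - m1 s x) <= c]].
Proof.
have [c1 c10 h1] := jost_half_plane hq1; have [c2 c20 h2] := jost_half_plane hq2.
exists (c1 + c2); first exact: addr_gt0.
move=> s s0 sc x x0.
have [|a1 a2 a3 a4] := h1 s s0 _ x x0; first lra.
have [|b1 b2 b3 b4] := h2 s s0 _ x x0; first lra.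
split; [by []|by []|lra|split; [by []|by []|lra|lra|]].
have := cabs_sub_trans 1 (m2 s x) (m1 s x); rewrite [cabs (1 - _)]cabsBC.
have := cabs_ge0 s; move: (cabs s) a3 b3 => z a3 b3 z0 h; nra.
Qed.

(* The logarithmic derivative of the cross term has real part bounded above for
   Re s <= 0, and the inhomogeneity is bounded, so Gronwall bounds it in terms of x only. *)
Lemma jost_cross_propagate : (forall s, jost_cross 0 s = 0) ->
  forall x s, 0 <= x -> jost_cross x s = 0.
Proof.
move=> N0 x s x0.
have [c c0 hc] := half_plane_bounds.
(* The rate 8c is twice the bound 4c on Re [al], and the extra 1 absorbs 2|N| b <= |N|^2 + b^2. The
   inhomogeneity satisfies |G| <= 2 c 4 4 = b. *)
pose a := 8 * c + 1; pose b := 32 * c.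
apply: (@odd_entire_eq0 _ _ (1 + b ^+ 2 * x * expR (a * x)) c).
- exact: jost_cross_entire.
- by move=> z; rewrite /jost_cross opprK; ring.
move=> {}s s0 sc.
pose N y := jost_cross y s.
pose N' y := (p1 (- s) y * m2 s y + m1 (- s) y * p2 s y) -
  (p1 s y * m2 (- s) y + m1 s y * p2 (- s) y).
have pN : cprimitive 0 x N N'.
  exact: (cprimitiveB (cprimitiveM (jost_m_cprimitive hq1 (- s) 0 x) (jost_m_cprimitive hq2 s 0 x))
    (cprimitiveM (jost_m_cprimitive hq1 s 0 x) (jost_m_cprimitive hq2 (- s) 0 x))).
have two : cabs (2 : C) = 2 by exact: cabs_nat.
have bound y : 0 <= y -> 2 * Re (conjc (N y) * N' y) <= a * cabs (N y) ^+ 2 + b ^+ 2.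
  move=> y0; have [h1 h2 h3 [h4 h5 h6 _ h7]] := hc s s0 sc y y0.
  have V1 := jost_wronskian hq1 s y; have V2 := jost_wronskian hq2 s y.
  (* Solving the two Wronskian identities for the terms at -s gives N' = (2s + al) N + G, where [al]
     and [G] involve only m and p at s. *)
  pose al := p1 s y / m1 s y + p2 s y / m2 s y.
  pose G := -2 * s * (m2 s y - m1 s y) * (m2 s y + m1 s y) / (m1 s y * m2 s y).
  have n1 : m1 s y != 0 by rewrite -cabs_gt0; lra.
  have n2 : m2 s y != 0 by rewrite -cabs_gt0; lra.
  have EN : N' y = (2 * s + al) * N y + G.
    apply: (mulfI (mulf_neq0 n1 n2)).
    have -> : m1 s y * m2 s y * ((2 * s + al) * N y + G) =
      2 * s * m1 s y * m2 s y * N y + (m2 s y * p1 s y + m1 s y * p2 s y) * N y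
      - 2 * s * (m2 s y - m1 s y) * (m2 s y + m1 s y).
      by rewrite /al /G; field; rewrite n1 n2.
    apply/eqP; rewrite -subr_eq0; apply/eqP.
    (* The equation for N is m2^2 times the first Wronskian identity minus m1^2 times the second. *)
    transitivity (m2 s y ^+ 2 * ((-2 * s * m1 s y * m1 (- s) y + m1 s y * p1 (- s) y
       - m1 (- s) y * p1 s y) + 2 * s)
     - m1 s y ^+ 2 * ((-2 * s * m2 s y * m2 (- s) y + m2 s y * p2 (- s) y
       - m2 (- s) y * p2 s y) + 2 * s)).
      by rewrite /N /N' /jost_cross; ring.
    by rewrite V1 V2; ring.
  have Gb : cabs G <= b.
    rewrite /G cabsM cabsV !cabsM cabsN two.
    rewrite ler_pdivrMr; last by rewrite mulr_gt0 ?cabs_gt0.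
    have h8 := cabsD (m2 s y) (m1 s y).
    have h9 : cabs (m2 s y + m1 s y) <= 4 by lra.
    have h10 : 4^-1 <= cabs (m1 s y) * cabs (m2 s y).
      have -> : 4^-1 = 2^-1 * 2^-1 :> R by field.
      by rewrite ler_pM // invr_ge0.
    rewrite /b.
    apply: (@le_trans _ _ (2 * c * 4)).
      rewrite -[2 * cabs s * _]mulrA ler_pM ?mulr_ge0 ?cabs_ge0 //.
      by rewrite ler_wpM2l.
    by have -> : 2 * c * 4 = 32 * c * 4^-1 by [field|]; rewrite ler_wpM2l ?mulr_ge0 ?(ltW c0).
  have alb : Re al <= 4 * c.
    have q_bound u v : v != 0 -> cabs u <= c -> 2^-1 <= cabs v -> cabs (u / v) <= 2 * c.
      move=> v0 uc vc; rewrite cabsM cabsV.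
      by rewrite ler_pdivrMr ?cabs_gt0 //; nra.
    rewrite /al cReD.
    have := le_trans (ler_norm _) (le_trans (cabs_Re (p1 s y / m1 s y)) (q_bound _ _ n1 h3 h2)).
    have := le_trans (ler_norm _) (le_trans (cabs_Re (p2 s y / m2 s y)) (q_bound _ _ n2 h6 h5)).
    lra.
  rewrite EN.
  have -> : 2 * Re (conjc (N y) * ((2 * s + al) * N y + G)) =
     (4 * Re s + 2 * Re al) * cabs (N y) ^+ 2 + 2 * Re (conjc (N y) * G).
    rewrite cabs_sqr; case: (N y) => e f; case: (s) => g h; case: (al) => i j; case: (G) => k l /=.
    ring.
  have rG : Re (conjc (N y) * G) <= cabs (N y) * b.
    rewrite (le_trans (ler_norm _)) // (le_trans (cabs_Re _)) // cabsM cabs_conj.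
    by rewrite ler_wpM2l ?cabs_ge0.
  have sq := sqr_ge0 (cabs (N y) - b).
  have : (4 * Re s + 2 * Re al) * cabs (N y) ^+ 2 <= 8 * c * cabs (N y) ^+ 2.
    by rewrite ler_wpM2r ?sqr_ge0 //; lra.
  rewrite /a; move: rG sq; rewrite sqrrB; lra.
have pE := primitiveM (primitive_cabs_sqr pN) (primitive_expR 0 x (- a)).
have pid : primitive 0 x (fun y => b ^+ 2 * y) (fun=> b ^+ 2).
  split; first exact: bounded_measurable_cst.
  by move=> u v _ uv _; rewrite Rintegral_itv_cst //; ring.
have a0 : 0 <= a by rewrite /a addr_ge0 // mulr_ge0 // ltW.
(* Gronwall: b^2 y - |N(y)|^2 e^(-ay) is nondecreasing and vanishes at y = 0. *)
have := primitive_ge0 x0 (primitiveB pid pE) _; rewrite mulr0 /N N0 cabs0 expr0n mul0r subrr.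
move=> /(_ _)/wrap[y y0 yx|].
  have e1 : expR (- a * y) <= 1.
    by rewrite -[leRHS]expR0 ler_expR mulNr oppr_le0 mulr_ge0.
  have e0 := expR_ge0 (- a * y).
  have := bound y y0; rewrite -/(N y).
  have b2 := sqr_ge0 b.
  move: (2 * Re _) (cabs (N y) ^+ 2) (b ^+ 2) b2 (expR (- a * y)) e0 e1 => P E B B0 e e0 e1.
  nra.
rewrite subr_ge0 mulNr expRN ler_pdivrMr ?expR_gt0 // => h.
have n0 := cabs_ge0 (jost_cross x s).
have := sqr_ge0 (cabs (jost_cross x s) - 1).
rewrite sqrrB; lra.
Qed.

Lemma jost_m_unique x s : 0 <= x -> (forall z, jost_cross x z = 0) -> s != 0 ->
  m1 s x = m2 s x.
Proof.
move=> x0 N0 s0.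
have [c c0 hc] := half_plane_bounds.
have key z : m2 z x * (mixed_wronskian x z + 2 * z) = 2 * z * (m2 z x - m1 z x).
  have V2 := jost_wronskian hq2 z x.
  apply/eqP; rewrite -subr_eq0; apply/eqP.
  (* N = 0 trades m1(-z) m2(z) for m1(z) m2(-z), after which the Wronskian identity of the second
     potential factors out. *)
  transitivity (m1 z x * ((-2 * z * m2 z x * m2 (- z) x + m2 z x * p2 (- z) x
       - m2 (- z) x * p2 z x) + 2 * z) - jost_cross x z * (z * m2 z x + p2 z x)).
    by rewrite /mixed_wronskian /jost_cross; ring.
  by rewrite V2 N0; ring.
have two : cabs (2 : C) = 2 by exact: cabs_nat.
have H0 : forall z, mixed_wronskian x z + 2 * z = 0.
  apply: (@odd_entire_eq0 _ _ (4 * c) c).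
  - apply: entireD; first exact: mixed_wronskian_entire.
    apply: entireM; last exact: entireX.
    by have := entireC (2 : R); rewrite (rmorph_nat (real_complex R)).
  - by move=> z; rewrite /mixed_wronskian opprK; ring.
  move=> z z0 zc; have [h1 h2 h3 [h4 h5 h6 _ h7]] := hc z z0 zc x x0.
  have := congr1 cabs (key z); rewrite !cabsM two.
  have := cabs_ge0 (mixed_wronskian x z + 2 * z).
  move: (cabs (mixed_wronskian x z + 2 * z)) (cabs (m2 z x)) h5 => w u hu w0; nra.
have := key s; rewrite H0 mulr0 => /esym /eqP; rewrite !mulf_eq0 pnatr_eq0 (negbTE s0) /=.
by rewrite subr_eq0 => /eqP.
Qed.

(** Since [g] is Lipschitz, its integral over [a, a+d] is d g(a) up to O(d^2), and that integral is
    zero. *)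
Lemma cprimitive_zero (g h : R -> C) a b : a < b -> cprimitive a b (fun=> 0) g ->
  cprimitive a b g h -> g a = 0.
Proof.
move=> ab p0 pg; have [B hB] := cprimitive_bounded pg.
have B0 : 0 <= B := le_trans (cabs_ge0 _) (hB a (lexx a) (ltW ab)).
apply: cabs_small_eq0 => e e0.
pose d := Num.min (b - a) (e / (4 * B + 1)).
have B1 : 0 < 4 * B + 1 by rewrite ltr_wpDl // mulr_ge0.
have d0 : 0 < d by rewrite lt_min subr_gt0 ab divr_gt0.
have db : a + d <= b by rewrite -lerBrDl ge_min lexx.
have de : d * (4 * B + 1) <= e by rewrite -ler_pdivlMr // ge_min lexx orbT.
have ad : a <= a + d by rewrite lerDl ltW.
have sub u v y : cprimitive a b u v -> y <= b -> cprimitive a y u v.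
  by move=> [h1 h2] yb; split; [apply: primitive_sub h1|apply: primitive_sub h2].
have gb y : a <= y -> y <= a + d -> cabs (g y - g a) <= 2 * B * d.
  move=> ay yd; have yb := le_trans yd db.
  have := cprimitive_bound (B := B) ay (sub _ _ _ pg yb) _.
  move=> /(_ _)/wrap[t at_ ty|le_g].
    by apply: hB => //; exact: le_trans yb.
  rewrite (le_trans le_g) // ler_wpM2l ?mulr_ge0 //.
  by rewrite lerBlDl.
have := cprimitive_bound ad (cprimitiveB (sub _ _ _ p0 db) (cprimitive_id a (a + d) (g a))) gb.
have -> : 0 - (a + d)%:C%C * g a - (0 - a%:C%C * g a) = - (d%:C%C * g a).
  by rewrite rmorphD /=; ring.
rewrite cabsN cabsM cabsR gtr0_norm // addrAC subrr add0r => le_ga.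
have : cabs (g a) <= 4 * B * d by rewrite -(ler_pM2l d0) (le_trans le_ga) //; nra.
by move=> /le_trans; apply; nra.
Qed.

(** Equal m at one value of s gives equal p, and the equation for p then shows that (q1 - q2) m1
    integrates to zero over every [0, x]. *)
Lemma rapid_potential_unique : (forall s, jost_cross 0 s = 0) ->
  {ae mu, forall x, 0 < x -> q1 x = q2 x}.
Proof.
move=> N0.
have meq x s : 0 <= x -> s != 0 -> m1 s x = m2 s x.
  move=> x0 s0; apply: jost_m_unique => // z; exact: jost_cross_propagate.
have [c c0 hc] := half_plane_bounds.
(* The point lies in the half-plane, and |s| = 2c forces |m1 - 1| <= 1/2, so Re m1 cannot vanish. *)
pose s : C := (- (2 * c))%:C%C.
have cs : cabs s = 2 * c by rewrite cabsR normrN gtr0_norm ?mulr_gt0.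
have s0 : s != 0 by rewrite -cabs_gt0 cs mulr_gt0.
have peq x : 0 <= x -> p1 s x = p2 s x.
  move=> x0; apply/eqP; rewrite -subr_eq0; apply/eqP.
  have x1 : x < x + 1 by rewrite ltrDl.
  apply: (@cprimitive_zero (fun x => p1 s x - p2 s x) _ x (x + 1) x1); last first.
    exact: cprimitiveB (jost_p_cprimitive hq1 s _ _) (jost_p_cprimitive hq2 s _ _).
  apply: eq_cprimitive (cprimitiveB (jost_m_cprimitive hq1 s x (x + 1))
    (jost_m_cprimitive hq2 s x (x + 1))) => y xy _ //.
  by rewrite meq ?subrr // (le_trans x0).
pose g x := (q1 x - q2 x) * Re (m1 s x).
have [gf _] : cfast (fun x => (q1 x)%:C%C * m1 s x - (q2 x)%:C%C * m1 s x).
  have [h1 _] := jost_cfast hq1 s.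
  by apply: cfastB; [exact: (rapid_cfastM1 hq1)|exact: (rapid_cfastM1 hq2)].
have {}gf : fast g.
  move: gf; congr fast; apply/funext => x.
  by rewrite cReD cReN !cReRM /g mulrBl.
have [l l0 gl] := fast_pos gf.
have gint x : 0 <= x -> \int[mu]_(t in `[0, x]) g t = 0.
  move=> x0.
  have := cprimitiveB (jost_p_cprimitive hq1 s 0 x) (jost_p_cprimitive hq2 s 0 x).
  move=> [[_ /(_ 0 x (lexx 0) x0 (lexx x))] + _].
  rewrite !peq // !subrr => h; rewrite [RHS]h; apply: eq_Rintegral => t /set_mem tx.
  have /andP[t0 _] : 0 <= t <= x by move: tx; rewrite /= in_itv.
  by rewrite !(cReD, cReN) !cReRM peq // -meq // /g; ring.
have ig := exp_decay_integrable 0 l0 gl.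
have lg := integrable_locally_restrict (measurable_itv _) ig.
have ig0 y : mu.-integrable `[0, y] (EFin \o (g \_ `[0, +oo[)).
  have := bounded_measurable_integrable (exp_decay_bounded_measurable 0 y l0 gl) (lexx 0) (lexx y).
  apply: eq_integrable => // t /set_mem /=; rewrite in_itv /= => /andP[t0 _].
  by rewrite patchE mem_set //= in_itv /= t0.
(* Lebesgue differentiation: almost everywhere [g] is the derivative of its indefinite integral,
   which is identically zero. *)
have ft := FTC1 (a := BLeft 0) ig0 lg.
apply: (@filterS _ _ (ae_filter_ringOfSetsType mu) _ _ _ ft) => x hF x0.
have /hF [_] : ((0 : R)%:E < x%:E)%E by rewrite lte_fin.
set F := (fun x => _).
have -> : F = cst 0.
  apply/funext => y; rewrite /F /=; have [y0|y0] := leP 0 y; last first.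
    by rewrite set_itv_ge ?bnd_simp -?ltNge // Rintegral_set0.
  rewrite -[RHS](gint y y0); apply: eq_Rintegral => t /set_mem /=.
  rewrite in_itv /= => /andP[t0 _].
  by rewrite patchE mem_set //= in_itv /= t0.
rewrite derive1_cst patchE mem_set /=; last by rewrite in_itv /= andbT ltW.
move=> /esym /eqP; rewrite mulf_eq0 subr_eq0 => /orP[/eqP //|/eqP m0].
have [||_ _ _ [_ _ _ h _]] := hc s _ _ x (ltW x0).
- by rewrite /= oppr_le0 mulr_ge0 // ltW.
- by rewrite cs; lra.
have := cabs_Re (m1 s x - 1); rewrite cReD cReN m0 /= sub0r normrN normr1 => h1.
rewrite cs in h; nra.
Qed.

End InverseProblem.

Theorem theorem2p3 (R : realType) (q1 q2 delta1 delta2 : R -> R)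
  (hq1 : L11 q1) (hq2 : L11 q2)
  (hdecay1 : superexp_decay q1) (hdecay2 : superexp_decay q2)
  (hdelta1 : phase_shift q1 delta1) (hdelta2 : phase_shift q2 delta2)
  (hdata : forall k : R, 0 < k -> delta1 k = delta2 k) :
  {ae @lebesgue_measure R, forall x : R, 0 < x -> q1 x = q2 x}.
Proof.
have [r1 hr1 e1] := superexp_rapid hq1 hdecay1.
have [r2 hr2 e2] := superexp_rapid hq2 hdecay2.
have [F1 [J1 ph1 _ _]] := hdelta1; have [F2 [J2 ph2 _ _]] := hdelta2.
have N0 : forall s, jost_cross r1 r2 0 s = 0.
  apply: entire_identity; first exact: jost_cross_entire.
  move=> k k0 _; rewrite /jost_cross; set s := (k%:C * 'i)%C.
  (* At s = ik the cross term becomes conj(F1) F2 - F1 conj(F2). It vanishes because F1 and F2 are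
     real multiples of the same unimodular number. *)
  have -> : - s = conjc s by apply: complex_ext => /=; ring.
  rewrite !(jost_m_conj hr1) !(jost_m_conj hr2).
  rewrite -(jost_function_eq hr1 k0 e1 J1) -(jost_function_eq hr2 k0 e2 J2).
  rewrite (ph1 k k0) (ph2 k k0) hdata //.
  move: (cabs (F1 k)) (cabs (F2 k)) (expi _) => x y [z w].
  by apply: complex_ext => /=; ring.
have h := rapid_potential_unique hr1 hr2 N0.
have ae := ae_filter_ringOfSetsType (@lebesgue_measure R).
apply: (@filterS3 _ _ ae _ _ _ _ _ e1 e2 h) => x a b d x0.
by rewrite a // b // d.
Qed.
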